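(* Let $H$ be a separable infinite dimensional complex Hilbert space, let $B(H)$ be the algebra of all bounded linear operators on $H$, and let ${}^{tr}$ denote the transpose with respect to an arbitrary but fixed complete orthonormal sequence in $H$. Suppose that $\phi:B(H)\to B(H)$ is a linear bijection which preserves the projections of infinite rank and infinite corank in both directions, i.e., for every $P\in B(H)$, $P$ is a projection of infinite rank and infinite corank if and only if $\phi(P)$ is a projection of infinite rank and infinite corank. Then there is a unitary operator $U\in B(H)$ such that either \[ \phi(T)=UTU^* \quad \text{for all } T\in B(H), \] or \[ \phi(T)=UT^{tr}U^* \quad \text{for all } T\in B(H). \]
   Context: A projection is a self-adjoint idempotent in $B(H)$. An operator $A\in B(H)$ has infinite rank and infinite corank if the Hilbert space dimensions of $\overline{\operatorname{rng} A}$ and of $\overline{\operatorname{rng} A}^{\perp}$ are both infinite, where $\operatorname{rng} A$ is the range of $A$. The transpose of $T\in B(H)$ with respect to a complete orthonormal sequence $(e_n)$ in $H$ is the operator $T^{tr}\in B(H)$ determined by $\langle T^{tr}e_i,e_j\rangle=\langle Te_j,e_i\rangle$ for all $i,j$. *)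

(* Defs.v *)
From HB Require Import structures.
From mathcomp Require Import all_boot all_order all_algebra.
From mathcomp Require Import all_classical all_reals all_analysis.
From mathcomp Require Export complex.

Set Implicit Arguments.
Unset Strict Implicit.
Unset Printing Implicit Defensive.
Import Order.TTheory GRing.Theory Num.Theory.
Import numFieldNormedType.Exports.

Local Open Scope classical_set_scope.
Local Open Scope ring_scope.

(* The inner product is linear in its first argument and conjugate-linear in
   the second one. The norm takes its values in R[i]. *)
HB.mixin Record CompleteNormedModule_isHilbert (R : realType) H
    of CompleteNormedModule R[i] H := {
  inner : {dot H for (@Num.conj R[i])};
  sqr_norm_inner : forall x : H, `|x| ^+ 2 = inner x x
}.

#[short(type="hilbertType")]
HB.structure Definition Hilbert (R : realType) :=
  {H of CompleteNormedModule R[i] H & CompleteNormedModule_isHilbert R H}.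

Arguments inner {R s}.

Section bounded_operators.
Context {R : realType} (H : hilbertType R).

Definition bounded_op : {pred H -> H} := mem
  [set f : H -> H | linear f /\ exists M : R[i], forall x, `|f x| <= M * `|x|].

Fact bounded_op_submod : submod_closed bounded_op.
Proof.
split=> [|a f g].
  rewrite inE; split=> [b x y|]; first by rewrite /= scaler0 addr0.
  by exists 0 => x; rewrite mul0r normr0.
rewrite !inE => -[lf [M fM]] [lg [N gN]]; split=> [b x y|].
  have -> z : (a *: f + g) z = a *: f z + g z by [].
  rewrite lf lg 2!scalerDr !scalerA (mulrC b) -!addrA; congr (_ + _).
  by rewrite addrCA.
exists (`|a| * M + N) => x.
have -> : (a *: f + g) x = a *: f x + g x by [].
rewrite mulrDl (le_trans (ler_normD _ _))// lerD// normrZ -mulrA.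
by rewrite ler_wpM2l.
Qed.

HB.instance Definition _ :=
  GRing.isSubmodClosed.Build R[i] (H -> H) bounded_op bounded_op_submod.

Record bop := Bop { bop_fun :> H -> H ; _ : bop_fun \in bounded_op }.

HB.instance Definition _ := [isSub for bop_fun].
HB.instance Definition _ := [Choice of bop by <:].
HB.instance Definition _ := [SubChoice_isSubLmodule of bop by <:].

Lemma bopP (A B : bop) : (forall x, A x = B x) -> A = B.
Proof. by move=> AB; apply/val_inj/funext. Qed.

Fact bop_linear (A : bop) : linear A.
Proof. by case: A => f /=; rewrite inE => -[]. Qed.

HB.instance Definition _ (A : bop) :=
  GRing.isLinear.Build R[i] H H _ A (bop_linear A).

Lemma bop_bounded (A : bop) : exists M : R[i], forall x, `|A x| <= M * `|x|.
Proof. by case: A => f /=; rewrite inE => -[]. Qed.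

Fact bounded_op_id : (id : H -> H) \in bounded_op.
Proof. by rewrite inE; split=> //; exists 1 => x; rewrite mul1r. Qed.

Fact bounded_op_comp (A B : bop) : A \o B \in bounded_op.
Proof.
rewrite inE; split=> [a x y|]; first by rewrite /= !linearP.
have [M AM] := bop_bounded A; have [N BN] := bop_bounded B.
exists (`|M| * N) => x /=; rewrite (le_trans (AM _))// -mulrA.
have /ler_wpM2l/(_ _ _ (BN x)) := normr_ge0 M; apply: le_trans.
case: (eqVneq (B x) 0) => [->|Bx0]; first by rewrite normr0 !mulr0.
rewrite ler_wpM2r// real_ler_norm// ger0_real//.
by rewrite -(pmulr_lge0 _ (_ : 0 < `|B x|)) ?normr_gt0// (le_trans _ (AM _)).
Qed.

Definition bop_one : bop := Bop bounded_op_id.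
Definition bop_mul (A B : bop) : bop := Bop (bounded_op_comp A B).

Fact bop_mulA : associative bop_mul. Proof. by move=> ? ? ?; apply: bopP. Qed.
Fact bop_mul1l : left_id bop_one bop_mul. Proof. by move=> ?; apply: bopP. Qed.
Fact bop_mul1r : right_id bop_one bop_mul. Proof. by move=> ?; apply: bopP. Qed.
Fact bop_mulDl : left_distributive bop_mul +%R.
Proof. by move=> ? ? ?; apply: bopP. Qed.
Fact bop_mulDr : right_distributive bop_mul +%R.
Proof. by move=> A B C; apply: bopP => x; exact: (linearD A). Qed.

(* The product of the ring B(H) is composition. *)
HB.instance Definition _ := GRing.Zmodule_isPzRing.Build bop
  bop_mulA bop_mul1l bop_mul1r bop_mulDl bop_mulDr.

End bounded_operators.

Section operators.
Context {R : realType} {H : hilbertType R}.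
Implicit Types (A P T U : bop H) (B M : set H) (e : nat -> H).

(* The adjoint, characterized by <A x, y> = <x, A^* y>; the default value 0 is
   never used, since every bounded operator has a unique adjoint. *)
Definition adjoint A : bop H :=
  xget 0 [set A' : bop H | forall x y, inner (A x) y = inner x (A' y)].

Definition unitary U := adjoint U * U = 1 /\ U * adjoint U = 1.

Definition projection P := adjoint P = P /\ P * P = P.

Definition orthogonal_complement M : set H :=
  [set x | forall y, M y -> inner x y = 0].

(* B is a complete orthonormal system in the closed subspace M. *)
Definition orthonormal_basis M B :=
  [/\ B `<=` M,
      forall x y, B x -> B y -> inner x y = `[< x = y >]%:R
    & M `&` orthogonal_complement B `<=` [set 0]].

Definition infinite_hilbert_dim M :=
  exists B, orthonormal_basis M B /\ infinite_set B.

Definition infinite_rank A := infinite_hilbert_dim (closure (range A)).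

Definition infinite_corank A :=
  infinite_hilbert_dim (orthogonal_complement (closure (range A))).

Definition infinite_coinfinite_projection P :=
  [/\ projection P, infinite_rank P & infinite_corank P].

Definition complete_orthonormal_sequence e :=
  (forall i j, inner (e i) (e j) = (i == j)%:R) /\
  orthonormal_basis setT (range e).

(* The transpose with respect to e. For a complete orthonormal sequence e it
   exists and is unique, so that the default value 0 is never used. *)
Definition transpose e T : bop H :=
  xget 0 [set T' : bop H |
    forall i j, inner (T' (e i)) (e j) = inner (T (e j)) (e i)].

End operators.

Definition separable_space (T : topologicalType) :=
  exists A : set T, countable A /\ dense A.

(* Main.v *)
(* Let Phi be the linear bijection. If a projection P has infinite corank, split
  off two orthogonal projections Q1, Q2 of infinite rank inside a part of its
  kernel. The sums Q1 + Q2, P + Qi and P + Q1 + Q2 are all of infinite rank and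
  corank, and projections whose sum is a projection are orthogonal, so Phi(P) is
  again a projection of infinite corank and Phi preserves orthogonality. Minimal
  projections then go to minimal projections: Phi(x (x) x) = y (x) y.

  Fix unit vectors with Phi(u (x) u) = f (x) f. For a unit v orthogonal to u,
  the images of the rank-one projections onto the vectors a u + b v force
  Phi(v (x) u) to be a unimodular multiple of either y (x) f or f (x) y. Each of
  the two alternatives holds on a subspace of u^perp, hence one of them holds
  throughout, and W x = Phi(x (x) u) f, resp. W x = Phi(u (x) x) f, is a linear,
  resp. antilinear, isometry with Phi(x (x) x) = W x (x) W x. Comparing a
  projection P of infinite rank and corank with P - x (x) x for x in its range
  and with P + x (x) x for x in its kernel gives Phi(P) W = W P.

  Since no continuity is assumed, this determines Phi only on the linear span of
  those projections, and the span is shown to be B(H). For a small self-adjoint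
  S, the 2 x 2 block [X, S; S, 1 - X] is a projection when X^2 + S^2 = X
  and X S = S X, so that all off-diagonal blocks are in the span; rotations
  give differences of diagonal blocks, and an infinite ampliation of a block
  turns such differences into the block itself. *)
Require Import Defs.
From mathcomp Require Import all_boot all_order all_algebra.
From mathcomp Require Import all_classical all_reals all_analysis.
From mathcomp Require Import ring zify.
Import Order.TTheory GRing.Theory Num.Theory.
Import numFieldNormedType.Exports.

Set Implicit Arguments.
Unset Strict Implicit.
Unset Printing Implicit Defensive.

Local Open Scope classical_set_scope.
Local Open Scope ring_scope.

(** * Inner products, limits and bounded operators *)

Section inner_product.
Context {R : realType} {H : hilbertType R}.
Local Notation C := R[i].
Implicit Types (x y z : H) (a : C) (A B : bop H).

Lemma inner_conj x y : inner y x = (inner x y)^*.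
Proof. by rewrite hermC /= expr0 mul1r. Qed.

Lemma innerDl x y z : inner (x + y) z = inner x z + inner y z.
Proof. exact: linearDl. Qed.

Lemma innerDr x y z : inner z (x + y) = inner z x + inner z y.
Proof. exact: linearDr. Qed.

Lemma innerNl x z : inner (- x) z = - inner x z.
Proof. exact: linearNl. Qed.

Lemma innerNr x z : inner z (- x) = - inner z x.
Proof. exact: linearNr. Qed.

Lemma innerZl a x z : inner (a *: x) z = a * inner x z.
Proof. exact: linearZl_LR. Qed.

Lemma innerZr a x z : inner z (a *: x) = a^* * inner z x.
Proof. exact: linearZr. Qed.

Lemma inner0l z : inner 0 z = 0.
Proof. exact: linear0l. Qed.

Lemma inner0r z : inner z 0 = 0.
Proof. exact: linear0r. Qed.

Definition innerE := (innerDl, innerDr, innerNl, innerNr, innerZl, innerZr,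
  inner0l, inner0r).

Lemma inner_suml I (r : seq I) (P : pred I) (F : I -> H) z :
  inner (\sum_(i <- r | P i) F i) z = \sum_(i <- r | P i) inner (F i) z.
Proof. exact: linear_sumlz. Qed.

Lemma inner_sumr I (r : seq I) (P : pred I) (F : I -> H) z :
  inner z (\sum_(i <- r | P i) F i) = \sum_(i <- r | P i) inner z (F i).
Proof. exact: linear_sumr. Qed.

Lemma inner_norm x : inner x x = `|x| ^+ 2.
Proof. by rewrite sqr_norm_inner. Qed.

Lemma inner_unit x : inner x x = 1 -> `|x| = 1.
Proof.
by rewrite inner_norm => /eqP; rewrite pexpr_eq1// => /eqP.
Qed.

Lemma inner_eq0 x y : inner x y = 0 -> inner y x = 0.
Proof. by rewrite inner_conj => /eqP; rewrite conjC_eq0 => /eqP. Qed.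

Lemma inner_inj x y : (forall z, inner x z = inner y z) -> x = y.
Proof.
move=> xy; apply/eqP; rewrite -subr_eq0 -normr_eq0 -sqrf_eq0 -inner_norm.
by rewrite innerDl innerNl xy subrr.
Qed.

Lemma norm_orthD x y : inner x y = 0 -> `|x + y| ^+ 2 = `|x| ^+ 2 + `|y| ^+ 2.
Proof.
move=> xy; have yx := inner_eq0 xy.
by rewrite -!inner_norm !innerE xy yx addr0 add0r.
Qed.

Lemma CauchySchwarz_inner x y : `|inner x y| <= `|x| * `|y|.
Proof.
have [->|y0] := eqVneq y 0; first by rewrite inner0r !normr0 mulr0.
have ny : 0 < `|y| by rewrite normr_gt0.
(* A rescaled component of [x] orthogonal to [y]; expanding [0 <= inner z z] gives the
   inequality. *)
pose z := `|y| ^+ 2 *: x - inner x y *: y.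
have zy : inner z y = 0 by rewrite !innerE inner_norm; ring.
have : 0 <= inner z z by rewrite inner_norm exprn_ge0.
rewrite {2}/z !innerDr !innerNr !innerZr zy mulr0 oppr0 addr0.
rewrite (CrealP (rpredX _ (normr_real _))) pmulr_rge0 ?exprn_gt0// !innerE.
rewrite inner_norm [inner y x]inner_conj -normCK subr_ge0 -exprMn mulrC.
by rewrite ler_pXn2r ?nnegrE ?mulr_ge0.
Qed.

Lemma bop_bound A : exists2 M : C, 0 <= M & forall x, `|A x| <= M * `|x|.
Proof.
have [M AM] := bop_bounded A; exists `|M| => // x.
have [->|x0] := eqVneq x 0; first by rewrite linear0 !normr0 mulr0.
rewrite (le_trans (AM x))// ler_wpM2r// real_ler_norm// ger0_real//.
by rewrite -(pmulr_lge0 _ (_ : 0 < `|x|)) ?normr_gt0// (le_trans _ (AM x)).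
Qed.

Lemma bop_app0 A : A 0 = 0. Proof. exact: linear0. Qed.

Lemma bop_appD A x y : A (x + y) = A x + A y. Proof. exact: linearD. Qed.

Lemma bop_appN A x : A (- x) = - A x. Proof. exact: linearN. Qed.

Lemma bop_appZ A a x : A (a *: x) = a *: A x. Proof. exact: linearZZ. Qed.

Lemma bop_app_sum A I (r : seq I) (P : pred I) (F : I -> H) :
  A (\sum_(i <- r | P i) F i) = \sum_(i <- r | P i) A (F i).
Proof. exact: linear_sum. Qed.

Definition bop_app := (bop_app0, bop_appD, bop_appN, bop_appZ).

Fact bop_of_subproof (f : H -> H) : linear f ->
  (exists M : C, forall x, `|f x| <= M * `|x|) -> f \in bounded_op (H := H).
Proof. by move=> lf bf; rewrite inE. Qed.

Definition bop_of (f : H -> H) (lf : linear f)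
  (bf : exists M : C, forall x, `|f x| <= M * `|x|) : bop H :=
  Bop (bop_of_subproof lf bf).

Lemma bop_continuous A : continuous A.
Proof.
move=> x; have [M M0 AM] := bop_bound A.
have M1 : 0 < M + 1 by rewrite ltr_wpDl.
apply/cvgrPdist_lt => e e0; near=> y.
rewrite -linearB (le_lt_trans (AM _))//.
rewrite (@le_lt_trans _ _ ((M + 1) * `|x - y|))//.
  by rewrite ler_wpM2r// lerDl.
rewrite -ltr_pdivlMl//; near: y; apply: cvgr_dist_lt => //.
by rewrite mulr_gt0 ?invr_gt0.
Unshelve. all: by end_near. Qed.

Lemma inner_continuousl y : continuous (fun x => inner x y : C^o).
Proof.
move=> x; have M1 : 0 < `|y| + 1 by rewrite ltr_wpDl.
apply/cvgrPdist_lt => e e0; near=> z.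
rewrite -innerNl -innerDl (le_lt_trans (CauchySchwarz_inner _ _))//.
rewrite (@le_lt_trans _ _ ((`|y| + 1) * `|x - z|))//.
  by rewrite mulrC ler_wpM2r// lerDl.
rewrite -ltr_pdivlMl//; near: z; apply: cvgr_dist_lt => //.
by rewrite mulr_gt0 ?invr_gt0.
Unshelve. all: by end_near. Qed.

Lemma cvg_bop A (u : H^nat) l : u @ \oo --> l -> A (u n) @[n --> \oo] --> A l.
Proof. by move=> ul; apply: continuous_cvg => //; exact: bop_continuous. Qed.

Lemma cvg_innerl y (u : H^nat) l :
  u @ \oo --> l -> (inner (u n) y : C^o) @[n --> \oo] --> inner l y.
Proof.
move=> ul.
apply: (@continuous_cvg _ _ _ _ _ _ (fun x => inner x y : C^o)) => //.
exact: inner_continuousl.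
Qed.

Arguments cvg_bop A {u l}.
Arguments cvg_innerl y {u l}.

Lemma cvg_innerr y (u : H^nat) l :
  u @ \oo --> l -> (inner y (u n) : C^o) @[n --> \oo] --> inner y l.
Proof.
move=> ul; apply/cvgrPdist_lt => e e0.
move/cvgrPdist_lt: (cvg_innerl y ul) => /(_ _ e0); apply: filterS => n.
by rewrite [inner y l]inner_conj [inner y (u n)]inner_conj -rmorphB norm_conjC.
Qed.

Arguments cvg_innerr y {u l}.

Lemma cvg_norm_le (u : H^nat) l (M : C) :
  u @ \oo --> l -> (forall n, `|u n| <= M) -> `|l| <= M.
Proof.
move=> /cvgrPdist_lt ul uM.
apply/ler_addgt0Pr => e /ul[N _ /(_ N (leqnn N)) uN].
rewrite -[l](subrK (u N)) (le_trans (ler_normD _ _))// addrC lerD//.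
exact: ltW.
Qed.

Lemma cvg_inner_eq (u : H^nat) l y (c : C) :
  u @ \oo --> l -> (\forall n \near \oo, inner (u n) y = c) -> inner l y = c.
Proof.
move=> /(cvg_innerl y) ul uc.
have uc' : (inner (u n) y : C^o) @[n --> \oo] --> (c : C^o).
  by apply: cvg_near_cst.
exact: (cvg_unique _ ul uc').
Qed.

Lemma norm_sum_orth (u : nat -> H) (r : seq nat) : uniq r ->
  (forall i j, i != j -> inner (u i) (u j) = 0) ->
  `|\sum_(k <- r) u k| ^+ 2 = \sum_(k <- r) `|u k| ^+ 2.
Proof.
move=> + ou; elim: r => [|i r IHr] /=; first by rewrite !big_nil normr0 expr0n.
case/andP => ir ur; rewrite !big_cons norm_orthD ?IHr// inner_sumr.
by rewrite big_seq big1// => j jr; apply: ou; apply: contraNneq ir => ->.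
Qed.

(** Pythagoras reduces the Cauchy criterion to the series of squared norms, whose partial sums are
    monotone and bounded. Real parts are taken because norms have values in [R[i]]. *)
Lemma cvg_series_orth (u : H^nat) (B : C) :
  (forall i j, i != j -> inner (u i) (u j) = 0) ->
  (forall n, \sum_(0 <= k < n) `|u k| ^+ 2 <= B) -> cvgn (series u).
Proof.
move=> ou uB; pose a k := complex.Re (`|u k| ^+ 2).
have aE k : (a k)%:C%C = `|u k| ^+ 2.
  by rewrite RRe_real// ger0_real// exprn_ge0.
have a0 k : 0 <= a k by rewrite -ler0c aE exprn_ge0.
have sa : cvgn (series a).
  apply: nondecreasing_is_cvgn; first exact: nondecreasing_series.
  exists (complex.Re B) => _ [n _ <-]; have := uB n.
  by rewrite lecE => /andP[_]; rewrite /series /= raddf_sum.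
apply/cauchy_cvgP/cauchy_seriesP => e e0.
have eE : (complex.Re e)%:C%C = e by rewrite RRe_real// gtr0_real.
have e1 : 0 < complex.Re e by rewrite -ltcR eE.
move/cauchy_cvgP/cauchy_seriesP : sa => /(_ _ (exprn_gt0 2 e1)).
apply: filterS => -[n m] /= am.
rewrite -(ltr_pXn2r (ltn0Sn 1)) ?nnegrE// ?ltW// norm_sum_orth ?iota_uniq//.
under eq_bigr do rewrite -aE.
rewrite -rmorph_sum -eE -rmorphXn ltcR.
by rewrite (le_lt_trans _ am)// ler_norm.
Qed.

Lemma cvg_series_dominated (u : H^nat) (a : R^nat) : cvgn (series a) ->
  (forall k, `|u k| <= (a k)%:C%C) -> cvgn (series u).
Proof.
move=> sa ua; apply/cauchy_cvgP/cauchy_seriesP => e e0.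
have eE : (complex.Re e)%:C%C = e by rewrite RRe_real// gtr0_real.
have e1 : 0 < complex.Re e by rewrite -ltcR eE.
move/cauchy_cvgP/cauchy_seriesP : sa => /(_ _ e1).
apply: filterS => -[n m] /= am.
rewrite (le_lt_trans (ler_norm_sum _ _ _))//.
rewrite (@le_lt_trans _ _ (\sum_(n <= k < m) (a k)%:C%C)) ?ler_sum//.
by rewrite -rmorph_sum -eE ltcR (le_lt_trans _ am)// ler_norm.
Qed.

(** The common bound [M] passes to the pointwise limit. Adjoints, isometries, ampliations and
    quadratic roots are all obtained in this way below. *)
Lemma bop_lim (A_ : nat -> bop H) (M : C) :
  (forall n x, `|A_ n x| <= M * `|x|) -> (forall x, cvgn (A_ ^~ x)) ->
  exists A : bop H, forall x, A_ ^~ x @ \oo --> A x.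
Proof.
move=> AM Acvg; pose f x := lim (A_ ^~ x @ \oo).
have lf : linear f.
  move=> a x y; apply/cvg_lim => //.
  under eq_fun do rewrite linearP.
  exact: (cvgD (cvgZ (cvg_cst a) (Acvg x)) (Acvg y)).
have bf : exists M : C, forall x, `|f x| <= M * `|x|.
  by exists M => x; apply: cvg_norm_le (Acvg x) _ => n; exact: AM.
by exists (bop_of lf bf) => x; exact: Acvg.
Qed.

End inner_product.

Arguments cvg_bop {R H} A {u l}.
Arguments cvg_innerl {R H} y {u l}.
Arguments cvg_innerr {R H} y {u l}.

(** * Rank-one operators *)

Section rank_one.
Context {R : realType} {H : hilbertType R}.
Local Notation C := R[i].
Implicit Types (x y z : H) (a : C) (A B : bop H).

Fact rank_one_linear x y : linear (fun z => inner z y *: x).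
Proof. by move=> a u v; rewrite !innerE scalerDl scalerA. Qed.

Fact rank_one_bounded x y :
  exists M : C, forall z, `|inner z y *: x| <= M * `|z|.
Proof.
exists (`|y| * `|x|) => z; rewrite normrZ mulrAC ler_wpM2r// mulrC.
exact: CauchySchwarz_inner.
Qed.

Definition rank_one x y : bop H :=
  bop_of (rank_one_linear x y) (rank_one_bounded x y).

Lemma rank_oneE x y z : rank_one x y z = inner z y *: x.
Proof. by []. Qed.

Lemma bopDE A B x : (A + B) x = A x + B x. Proof. by []. Qed.
Lemma bopNE A x : (- A) x = - A x. Proof. by []. Qed.
Lemma bopZE a A x : (a *: A) x = a *: A x. Proof. by []. Qed.
Lemma bopME A B x : (A * B) x = A (B x). Proof. by []. Qed.
Lemma bop1E x : (1 : bop H) x = x. Proof. by []. Qed.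
Lemma bop0E x : (0 : bop H) x = 0. Proof. by []. Qed.

Lemma bop_sumE I (r : seq I) (P : pred I) (F : I -> bop H) x :
  (\sum_(i <- r | P i) F i) x = \sum_(i <- r | P i) F i x.
Proof. by elim/big_rec2: _ => //= i A y _ <-. Qed.

Definition bopE := (bopDE, bopNE, bopZE, bopME, bop1E, bop0E, rank_oneE).

Lemma bop_scaleAl a A B : a *: (A * B) = (a *: A) * B.
Proof. exact: bopP. Qed.

Lemma bop_scaleAr a A B : a *: (A * B) = A * (a *: B).
Proof. by apply: bopP => x; rewrite !bopE bop_appZ. Qed.

Lemma bop_inner_inj A B :
  (forall x y, inner (A x) y = inner (B x) y) -> A = B.
Proof. by move=> AB; apply: bopP => x; apply: inner_inj => y. Qed.

Lemma rank_oneDl x x' y : rank_one (x + x') y = rank_one x y + rank_one x' y.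
Proof. by apply: bopP => z; rewrite !bopE scalerDr. Qed.

Lemma rank_oneDr x y y' : rank_one x (y + y') = rank_one x y + rank_one x y'.
Proof. by apply: bopP => z; rewrite !bopE innerDr scalerDl. Qed.

Lemma rank_oneZl a x y : rank_one (a *: x) y = a *: rank_one x y.
Proof. by apply: bopP => z; rewrite !bopE !scalerA mulrC. Qed.

Lemma rank_oneZr a x y : rank_one x (a *: y) = a^* *: rank_one x y.
Proof. by apply: bopP => z; rewrite !bopE innerZr !scalerA. Qed.

Lemma rank_one0l y : rank_one 0 y = 0.
Proof. by apply: bopP => z; rewrite !bopE scaler0. Qed.

Lemma rank_one0r x : rank_one x 0 = 0.
Proof. by apply: bopP => z; rewrite !bopE inner0r scale0r. Qed.

Lemma mul_rank_one A x y : A * rank_one x y = rank_one (A x) y.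
Proof. by apply: bopP => z; rewrite !bopE bop_appZ. Qed.

End rank_one.

Definition isometric {R : realType} {H : hilbertType R} (V : bop H) :=
  adjoint V * V = 1.

(** * Orthonormal sequences, adjoints and isometries *)

Section orthonormal_sequence.
Context {R : realType} {H : hilbertType R}.
Local Notation C := R[i].
Implicit Types (x y z : H) (a : C) (A B : bop H) (f : nat -> H).

Definition orthonormal_seq f := forall i j, inner (f i) (f j) = (i == j)%:R.

Lemma norm_sum_orthonormal f (c : nat -> C) (r : seq nat) : uniq r ->
  orthonormal_seq f ->
  `|\sum_(k <- r) c k *: f k| ^+ 2 = \sum_(k <- r) `|c k| ^+ 2.
Proof.
move=> ur of_; rewrite norm_sum_orth//; last first.
  by move=> i j /negbTE ij; rewrite !innerE of_ ij !mulr0.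
apply: eq_bigr => k _; rewrite normrZ exprMn (_ : `|f k| = 1) ?expr1n ?mulr1//.
by apply: inner_unit; rewrite of_ eqxx.
Qed.

Lemma inner_sum_orthonormal f (c : nat -> C) n m : orthonormal_seq f ->
  (m < n)%N -> inner (\sum_(0 <= k < n) c k *: f k) (f m) = c m.
Proof.
move=> of_ mn; rewrite inner_suml (bigD1_seq m) ?mem_index_iota ?iota_uniq//=.
rewrite !innerE of_ eqxx mulr1 big1 ?addr0// => i /negbTE im.
by rewrite innerZl of_ im mulr0.
Qed.

Lemma cvg_orthonormal f (c : nat -> C) (B : C) : orthonormal_seq f ->
  (forall n, \sum_(0 <= k < n) `|c k| ^+ 2 <= B) ->
  cvgn (series (fun k => c k *: f k)).
Proof.
move=> of_ cB; apply: (@cvg_series_orth _ _ _ B) => [i j /negbTE ij|n].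
  by rewrite !innerE of_ ij !mulr0.
rewrite (le_trans _ (cB n))// ler_sum// => k _.
by rewrite normrZ exprMn (inner_unit _) ?expr1n ?mulr1// of_ eqxx.
Qed.

Lemma Bessel f x n : orthonormal_seq f ->
  \sum_(0 <= k < n) `|inner x (f k)| ^+ 2 <= `|x| ^+ 2.
Proof.
move=> of_; set s := \sum_(0 <= k < n) inner x (f k) *: f k.
have sx : inner (x - s) s = 0.
  rewrite /s inner_sumr big_nat big1// => k /andP[_ kn].
  by rewrite innerZr innerDl innerNl inner_sum_orthonormal// subrr mulr0.
rewrite -(norm_sum_orthonormal _ (iota_uniq _ _) of_) -/s.
by rewrite -[x in leRHS](subrK s) norm_orthD// lerDr exprn_ge0.
Qed.

End orthonormal_sequence.

Section basis.
Context {R : realType} {H : hilbertType R} (e : nat -> H).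
Hypothesis e_complete : complete_orthonormal_sequence e.
Local Notation C := R[i].
Implicit Types (x y z : H) (a : C) (A B P Q S T U V W : bop H) (f : nat -> H).

Lemma basis_orthonormal : orthonormal_seq e.
Proof. by case: e_complete. Qed.

Lemma basis_inj x y : (forall i, inner x (e i) = inner y (e i)) -> x = y.
Proof.
move=> xy; apply/eqP; rewrite -subr_eq0; apply/eqP.
case: e_complete => _ [_ _]; apply; split => // _ [i _ <-].
by rewrite innerDl innerNl xy subrr.
Qed.

(** Bessel's inequality makes the series converge; its limit has the same coefficients as [x], and
    completeness identifies the two. *)
Lemma basis_expansion x :
  series (fun k => inner x (e k) *: e k) @ \oo --> x.
Proof.
have oe := basis_orthonormal.
have /cvg_ex[/= l sl] := cvg_orthonormal oe (Bessel x ^~ oe).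
rewrite [X in _ --> X](_ : x = l)//; apply: basis_inj => i.
apply/esym/(cvg_inner_eq sl); exists i.+1 => // n /= ni.
exact: inner_sum_orthonormal.
Qed.

Arguments basis_expansion : clear implicits.

Lemma bop_basis_inj A B : (forall i, A (e i) = B (e i)) -> A = B.
Proof.
move=> AB; apply: bopP => x.
have AxP := cvg_bop A (basis_expansion x).
have := cvg_bop B (basis_expansion x).
rewrite [X in X @ _ --> _ -> _](_ : _ = fun n => 
  A (series (fun k => inner x (e k) *: e k) n)); last first.
  apply/funext => n; rewrite /series /= !bop_app_sum; apply: eq_bigr => i _.
  by rewrite !bop_appZ AB.
by move=> BxP; exact: (cvg_unique _ AxP BxP).
Qed.

Lemma bop_matrix_inj A B :
  (forall i j, inner (A (e i)) (e j) = inner (B (e i)) (e j)) -> A = B.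
Proof. by move=> AB; apply: bop_basis_inj => i; exact: basis_inj. Qed.

(** The adjoint at [y] is summed from the coefficients [inner y (A (e k))]. The partial sums are
    bounded by [M] because pairing [y] with [A (A_ n y)] gives the squared norm of [A_ n y]. *)
Lemma exists_adjoint A :
  exists A' : bop H, forall x y, inner (A x) y = inner x (A' y).
Proof.
have oe := basis_orthonormal.
have [M M0 AM] := bop_bound A.
pose A_ n : bop H := \sum_(0 <= k < n) rank_one (e k) (A (e k)).
have A_E n y : A_ n y = \sum_(0 <= k < n) inner y (A (e k)) *: e k.
  by rewrite bop_sumE.
have A_M n y : `|A_ n y| <= M * `|y|.
  have [->|s0] := eqVneq (A_ n y) 0; first by rewrite normr0 mulr_ge0.
  have : inner y (A (A_ n y)) = `|A_ n y| ^+ 2.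
    rewrite A_E norm_sum_orthonormal ?iota_uniq// bop_app_sum inner_sumr.
    by apply: eq_bigr => k _; rewrite bop_appZ innerZr mulrC normCK.
  move=> yA; rewrite -(ler_pM2r (_ : 0 < `|A_ n y|)) ?normr_gt0// -expr2 -yA.
  rewrite -(ger0_norm (_ : 0 <= inner y _)) ?yA ?exprn_ge0// -yA.
  rewrite (le_trans (CauchySchwarz_inner _ _))//.
  by rewrite mulrC mulrAC ler_wpM2r.
have A_cvg y : cvgn (A_ ^~ y).
  rewrite (_ : A_ ^~ y = series (fun k => inner y (A (e k)) *: e k)).
    apply: (@cvg_orthonormal _ _ _ _ ((M * `|y|) ^+ 2)) => // n.
    rewrite -(norm_sum_orthonormal _ (iota_uniq _ _) oe) -A_E.
    by rewrite ler_pXn2r ?nnegrE// mulr_ge0.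
  by apply/funext => n; rewrite A_E.
have [A' A'P] := bop_lim A_M A_cvg; exists A' => x y.
have A'e i : inner (A' y) (e i) = inner y (A (e i)).
  apply: cvg_inner_eq (A'P y) _; exists i.+1 => // n /= ni.
  by rewrite A_E inner_sum_orthonormal.
have Ax := cvg_innerl y (cvg_bop A (basis_expansion x)).
have xA := cvg_innerl (A' y) (basis_expansion x).
move: Ax; rewrite [X in X @ _ --> _ -> _](_ : _ = fun n =>
  inner (series (fun k => inner x (e k) *: e k) n) (A' y)); last first.
  apply/funext => n; rewrite /series /= bop_app_sum !inner_suml.
  apply: eq_bigr => i _.
  by rewrite bop_appZ !innerZl; congr *%R; rewrite inner_conj -A'e -inner_conj.
by move=> Ax; exact: (cvg_unique _ Ax xA).
Qed.

Lemma adjointP A x y : inner (A x) y = inner x (adjoint A y).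
Proof. by have := xgetPex 0 (exists_adjoint A) => /= ->. Qed.

Lemma adjointPr A x y : inner x (A y) = inner (adjoint A x) y.
Proof. by rewrite inner_conj adjointP -inner_conj. Qed.

Lemma adjoint_unique A B :
  (forall x y, inner (A x) y = inner x (B y)) -> adjoint A = B.
Proof.
move=> AB; apply: bop_inner_inj => x y.
by rewrite -adjointPr inner_conj AB -inner_conj.
Qed.

Lemma adjointK : involutive (@adjoint R H).
Proof. by move=> A; apply: adjoint_unique => x y; rewrite adjointPr. Qed.

Lemma adjointD A B : adjoint (A + B) = adjoint A + adjoint B.
Proof.
by apply: adjoint_unique => x y; rewrite !bopE !innerE !adjointP.
Qed.

Lemma adjointN A : adjoint (- A) = - adjoint A.
Proof. by apply: adjoint_unique => x y; rewrite !bopE !innerE !adjointP. Qed.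

Lemma adjointZ a A : adjoint (a *: A) = a^* *: adjoint A.
Proof.
by apply: adjoint_unique => x y; rewrite !bopE !innerE conjCK !adjointP.
Qed.

Lemma adjointM A B : adjoint (A * B) = adjoint B * adjoint A.
Proof. by apply: adjoint_unique => x y; rewrite !bopE !adjointP. Qed.

Lemma adjoint1 : adjoint 1 = 1 :> bop H.
Proof. exact: adjoint_unique. Qed.

Lemma adjoint0 : adjoint 0 = 0 :> bop H.
Proof. by apply: adjoint_unique => x y; rewrite !bopE !innerE. Qed.

Lemma adjoint_mul_eq0 A B : adjoint A * B = 0 -> adjoint B * A = 0.
Proof. by move=> AB; rewrite -(adjointK A) -adjointM AB adjoint0. Qed.

Lemma adjoint_rank_one x y : adjoint (rank_one x y) = rank_one y x.
Proof.
by apply: adjoint_unique => u v; rewrite !bopE !innerE -inner_conj mulrC.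
Qed.

Definition adjointE :=
  (adjointM, adjointD, adjointN, adjointZ, adjoint1, adjoint0, adjointK).

Lemma rank_one_mul x y A : rank_one x y * A = rank_one x (adjoint A y).
Proof. by apply: bopP => z; rewrite !bopE adjointP. Qed.

Lemma isometricP V :
  isometric V <-> forall x y, inner (V x) (V y) = inner x y.
Proof.
split=> [VV x y|VV]; first by rewrite adjointP -bopME VV.
by apply: bop_inner_inj => x y; rewrite bopME -adjointPr VV.
Qed.

Lemma isometric_mul V W : isometric V -> isometric W -> isometric (V * W).
Proof.
move=> VV WW.
by rewrite /isometric adjointM mulrA -(mulrA (adjoint W)) VV mulr1.
Qed.

Lemma isometric_basis V : isometric V -> orthonormal_seq (fun n => V (e n)).
Proof. by move=> /isometricP VV i j; rewrite VV basis_orthonormal. Qed.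

(** The truncations [V_ n] are contractions by Bessel's inequality, hence have a pointwise limit. *)
Lemma exists_isometric f : orthonormal_seq f ->
  exists V : bop H, isometric V /\ forall n, V (e n) = f n.
Proof.
move=> of_; have oe := basis_orthonormal.
pose V_ n : bop H := \sum_(0 <= k < n) rank_one (f k) (e k).
have V_E n x : V_ n x = \sum_(0 <= k < n) inner x (e k) *: f k.
  by rewrite bop_sumE.
have V_M n x : `|V_ n x| <= 1 * `|x|.
  rewrite mul1r -(ler_pXn2r (ltn0Sn 1)) ?nnegrE// V_E.
  by rewrite (norm_sum_orthonormal _ (iota_uniq _ _) of_) Bessel.
have V_cvg x : cvgn (V_ ^~ x).
  rewrite (_ : V_ ^~ x = series (fun k => inner x (e k) *: f k)).
    by apply: cvg_orthonormal => // n; exact: Bessel.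
  by apply/funext => n; rewrite V_E.
have [V VP] := bop_lim V_M V_cvg.
have Ve m : V (e m) = f m.
  have Vem : V_ n (e m) @[n --> \oo] --> f m.
    apply: cvg_near_cst; exists m.+1 => // n /= mn; rewrite V_E.
    rewrite (bigD1_seq m) ?mem_index_iota ?iota_uniq//= oe eqxx scale1r.
    by rewrite big1 ?addr0// => i im; rewrite oe eq_sym (negbTE im) scale0r.
  exact: (cvg_unique _ (VP (e m)) Vem).
exists V; split=> //; apply: bop_matrix_inj => i j.
by rewrite bopME -adjointPr !Ve of_ oe.
Qed.

Lemma sum_bop_cvg (B_ : nat -> bop H) (M : C) : 0 <= M ->
  (forall i j x y, i != j -> inner (B_ i x) (B_ j y) = 0) ->
  (forall n x, \sum_(0 <= k < n) `|B_ k x| ^+ 2 <= (M * `|x|) ^+ 2) ->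
  exists B : bop H, forall x, series (B_ ^~ x) @ \oo --> B x.
Proof.
move=> M0 oB BM.
pose S n : bop H := \sum_(0 <= k < n) B_ k.
have SE n x : S n x = series (B_ ^~ x) n by rewrite bop_sumE.
have S_M n x : `|S n x| <= M * `|x|.
  rewrite -(ler_pXn2r (ltn0Sn 1)) ?nnegrE ?mulr_ge0// SE /series /=.
  by rewrite (@norm_sum_orth _ _ (B_ ^~ x)) ?iota_uniq// => i j /oB.
have S_cvg x : cvgn (S ^~ x).
  rewrite (_ : S ^~ x = series (B_ ^~ x)); last first.
    by apply/funext => n; rewrite SE.
  by apply: (@cvg_series_orth _ _ _ ((M * `|x|) ^+ 2)) => // i j /oB.
have [B BP] := bop_lim S_M S_cvg; exists B => x.
by rewrite (_ : series _ = S ^~ x)//; apply/funext => n; rewrite SE.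
Qed.

(** * Projections of infinite rank and infinite corank *)

(** The fixed points form the kernel of [P - 1], which is closed and contains the range. *)
Lemma projection_fix P x : projection P -> closure (range P) x <-> P x = x.
Proof.
move=> [_ PP]; split=> [|<-]; last by apply: subset_closure; exists x.
have cP : closed [set x : H | P x = x].
  have PE y : (P - 1) y = P y - y by [].
  rewrite (_ : mkset _ = (P - 1) @^-1` [set 0]).
    apply: preimage_closed => [y _|]; first exact: bop_continuous.
    apply: accessible_closed_set1.
    exact/hausdorff_accessible/norm_hausdorff.
  apply/seteqP; split => y; rewrite /preimage /mkset /set1 /mkset PE.
    by move=> ->; rewrite subrr.
  by move=> /eqP; rewrite subr_eq0 => /eqP.
have -> : (P x = x) = closure [set x | P x = x] x by rewrite -(closure_id _).1.
by apply: closureS => _ [z _ <-] /=; rewrite -bopME PP.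
Qed.

Lemma projection_ker P x : projection P ->
  orthogonal_complement (closure (range P)) x <-> P x = 0.
Proof.
move=> pP; split=> [xP|Px0 y /(projection_fix _ pP) <-]; last first.
  by rewrite adjointPr (proj1 pP) Px0 inner0l.
apply: inner_inj => y; rewrite inner0l adjointP (proj1 pP); apply: xP.
by apply: subset_closure; exists y.
Qed.

Lemma infinite_dim_orthonormal (M : set H) : infinite_hilbert_dim M ->
  exists f, orthonormal_seq f /\ forall n, M (f n).
Proof.
move=> [B [[BM oB _] /infiniteP/pcard_leP[f]]].
have Bf n : B (f n) by exact: funS.
exists f; split=> [i j|n]; last exact: BM.
rewrite oB//; congr (_%:R); congr nat_of_bool; apply/asboolP/eqP => [|->//].
by move=> /inj; apply; rewrite inE.
Qed.

(** A complete system is required, so Zorn's lemma enlarges [f] to a maximal orthonormal system in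
    [M]; a nonzero vector of [M] orthogonal to it could be normalised and added. *)
Lemma orthonormal_infinite_dim (M : set H) f :
  (forall a x, M x -> M (a *: x)) ->
  orthonormal_seq f -> (forall n, M (f n)) -> infinite_hilbert_dim M.
Proof.
move=> MZ of_ fM.
pose on (B : set H) := B `<=` M /\
  forall x y, B x -> B y -> inner x y = `[< x = y >]%:R.
have f_on : on (range f).
  split=> [_ [n _ <-]//|_ _ [i _ <-] [j _ <-]]; rewrite of_.
  have [->|ij] := eqVneq i j; first by rewrite asboolT.
  rewrite asboolF// => fij; have := of_ i j; rewrite fij of_ eqxx (negbTE ij).
  by apply/eqP; rewrite oner_eq0.
(* The order is put on the sets added to the range of [f], so that the union of the empty chain is
   admissible as well. *)
have [F Fon Ftot|A [[AM oA] Amax]] :=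
  @Zorn_bigcup H [set B | on (range f `|` B)].
  split=> [x [|[X /Fon[XM _] Xx]]|]; first exact: f_on.1.
    by apply: XM; right.
  move=> x y [fx|[X FX Xx]] [fy|[Y FY Yy]].
  - exact: f_on.2.
  - by apply: (Fon _ FY).2; [left|right].
  - by apply: (Fon _ FX).2; [right|left].
  - have [XY|YX] := Ftot _ _ FX FY.
      by apply: (Fon _ FY).2; right => //; exact: XY.
    by apply: (Fon _ FX).2; right => //; exact: YX.
exists (range f `|` A); split; last first.
  move=> /(sub_finite_set (@subsetUl _ _ A)) fin.
  have : finite_set (f @^-1` range f).
    apply: finite_preimage => // i j _ _ fij; have := of_ i j.
    by rewrite fij of_ eqxx; case: eqP => // _ /eqP; rewrite oner_eq0.
  by rewrite preimage_range; exact: infinite_nat.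
split=> // x [Mx xA] /=; apply: contrapT => /eqP x0.
pose u := `|x|^-1 *: x.
have uA y : (range f `|` A) y -> inner u y = 0.
  by move=> /xA xy; rewrite innerZl xy mulr0.
have uu : inner u u = 1.
  rewrite !innerE inner_norm conj_Creal ?rpredV ?normr_real//.
  by rewrite expr2 mulKf ?mulVf ?normr_eq0.
apply: (Amax (u |` A)).
  split=> [y Ay|/(_ u (or_introl erefl)) Au]; first by right.
  by have := uA u (or_intror Au); rewrite uu => /eqP; rewrite oner_eq0.
have uM : M u by exact: MZ.
split=> [y [fy|[->//|Ay]]|y z]; first by apply: AM; left.
  by apply: AM; right.
have main w : (range f `|` A) w -> inner u w = `[< u = w >]%:R /\
    inner w u = `[< w = u >]%:R.
  move=> Aw; have uw := uA w Aw; rewrite uw (inner_eq0 uw).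
  have uNw : u <> w.
    by move=> E; move: uw; rewrite -E uu => /eqP; rewrite oner_eq0.
  by split; rewrite asboolF// => /esym.
move=> yA zA; have {}yA : y = u \/ (range f `|` A) y.
  by case: yA => [?|[->|?]]; [right; left|left|right; right].
have {}zA : z = u \/ (range f `|` A) z.
  by case: zA => [?|[->|?]]; [right; left|left|right; right].
case: yA => [->|Ay]; case: zA => [->|Az].
- by rewrite uu asboolT.
- exact: (main z Az).1.
- exact: (main y Ay).2.
- exact: oA.
Qed.

(** An infinite orthonormal family in the range or the kernel of [P] is the image of [e] under an
    isometry, so both dimension conditions become equations between operators. *)
Lemma infinite_coinfiniteP P : infinite_coinfinite_projection P <->
  [/\ projection P, exists2 V, isometric V & P * V = V
    & exists2 V, isometric V & P * V = 0].
Proof.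
split=> [[pP /infinite_dim_orthonormal[f [of_ fP]]
             /infinite_dim_orthonormal[g [og gP]]]|].
  split=> //.
    have [V [VV Vf]] := exists_isometric of_; exists V => //.
    apply: bop_basis_inj => i; rewrite bopME Vf.
    exact: (projection_fix _ pP).1.
  have [V [VV Vf]] := exists_isometric og; exists V => //.
  apply: bop_basis_inj => i; rewrite bopME Vf.
  exact: (projection_ker _ pP).1.
move=> [pP [V VV PV] [W WW PW]]; split=> //.
  apply: (orthonormal_infinite_dim _ (isometric_basis VV)) => [a x|n].
    by rewrite !projection_fix// => Px; rewrite bop_appZ Px.
  by apply/projection_fix => //; rewrite -bopME PV.
apply: (orthonormal_infinite_dim _ (isometric_basis WW)) => [a x|n].
  by rewrite !projection_ker// => Px; rewrite bop_appZ Px scaler0.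
by apply/projection_ker => //; rewrite -bopME PW.
Qed.

(** Generators of the Cuntz algebra O_3, sending [e n] to [e (3 * n)], [e (3 * n + 1)] and
    [e (3 * n + 2)]. Two of them carry blocks while the third leaves room for an infinite corank. *)
Lemma exists_cuntz : exists a b c : bop H,
  [/\ isometric a, isometric b & isometric c] /\
  [/\ adjoint a * b = 0, adjoint a * c = 0, adjoint b * c = 0
    & a * adjoint a + b * adjoint b + c * adjoint c = 1].
Proof.
have oe := basis_orthonormal.
have sub r : exists V, isometric V /\ forall n, V (e n) = e (3 * n + r)%N.
  by apply: exists_isometric => i j; rewrite oe eqn_add2r eqn_mul2l.
have [a [aa ae]] := sub 0%N; have [b [bb be]] := sub 1%N.
have [c [cc ce]] := sub 2%N.
have ndvd i j : (3 * i == 3 * j + 1)%N = false /\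
    (3 * i == 3 * j + 2)%N = false /\ (3 * i + 1 == 3 * j + 2)%N = false.
  by split; last split; apply/negP => /eqP; lia.
have ab : adjoint a * b = 0.
  apply: bop_matrix_inj => i j; rewrite bopME -adjointPr ae be oe addn0.
  by rewrite eq_sym (ndvd _ _).1 bop0E inner0l.
have ac : adjoint a * c = 0.
  apply: bop_matrix_inj => i j; rewrite bopME -adjointPr ae ce oe addn0.
  by rewrite eq_sym (ndvd _ _).2.1 bop0E inner0l.
have bc : adjoint b * c = 0.
  apply: bop_matrix_inj => i j; rewrite bopME -adjointPr be ce oe.
  by rewrite eq_sym (ndvd _ _).2.2 bop0E inner0l.
exists a, b, c; do 2 split=> //.
have ba : adjoint b * a = 0 by exact: adjoint_mul_eq0 ab.
have ca : adjoint c * a = 0 by exact: adjoint_mul_eq0 ac.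
have cb : adjoint c * b = 0 by exact: adjoint_mul_eq0 bc.
set X := _ + _ + _.
have Xa : X * a = a.
  by rewrite /X !mulrDl -!mulrA aa ba ca !mulr0 mulr1 !addr0.
have Xb : X * b = b.
  by rewrite /X !mulrDl -!mulrA bb ab cb !mulr0 mulr1 addr0 add0r.
have Xc : X * c = c.
  by rewrite /X !mulrDl -!mulrA cc ac bc !mulr0 mulr1 !add0r.
apply: bop_basis_inj => i; rewrite bop1E (divn_eq i 3) mulnC.
have: (i %% 3 < 3)%N by rewrite ltn_mod.
by case: (i %% 3)%N => [|[|[|//]]] _;
  rewrite -?ae -?be -?ce -bopME ?Xa ?Xb ?Xc.
Qed.

Lemma bop_double_eq0 A : A + A = 0 -> A = 0.
Proof.
move=> AA; apply/eqP; have /eqP : (2 : C) *: A = 0.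
  by rewrite (_ : 2 = 1 + 1)// scalerDl scale1r.
by rewrite scaler_eq0 pnatr_eq0.
Qed.

Lemma projection_orthC P Q : projection P -> projection Q ->
  P * Q = 0 -> Q * P = 0.
Proof. by move=> [aP _] [aQ _] PQ; rewrite -aP -aQ -adjointM PQ adjoint0. Qed.

Lemma projectionD P Q : projection P -> projection Q -> P * Q = 0 ->
  projection (P + Q).
Proof.
move=> pP pQ PQ; have QP := projection_orthC pP pQ PQ.
split; first by rewrite adjointD (proj1 pP) (proj1 pQ).
by rewrite mulrDl !mulrDr PQ QP (proj2 pP) (proj2 pQ) addr0 add0r.
Qed.

Lemma projectionB P Q : projection P -> projection Q -> P * Q = Q ->
  projection (P - Q).
Proof.
move=> [aP PP] [aQ QQ] PQ; have QP : Q * P = Q by rewrite -aP -aQ -adjointM PQ.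
split; first by rewrite adjointD adjointN aP aQ.
by rewrite mulrBl !mulrBr PP PQ QP QQ subrr subr0.
Qed.

(** Idempotence of the sum gives [P * Q + Q * P = 0]. Multiplying by [P] on either side shows that
    both products equal [- (P * Q * P)], so they coincide and twice their value is 0. *)
Lemma projectionD_orth P Q : projection P -> projection Q ->
  projection (P + Q) -> P * Q = 0.
Proof.
move=> [_ PP] [_ QQ] [_]; rewrite mulrDl !mulrDr PP QQ.
rewrite (addrC (Q * P)) addrACA -[in RHS](addr0 (P + Q)) => /addrI PQ0.
have PQP : P * Q + P * Q * P = 0.
  by rewrite -[RHS](mulr0 P) -PQ0 mulrDr !mulrA PP.
have QPQ : P * Q * P + Q * P = 0.
  by rewrite -[RHS](mul0r P) -PQ0 mulrDl -(mulrA Q) PP.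
apply: bop_double_eq0; rewrite -[RHS]PQ0; congr (_ + _).
by apply/(addrI (P * Q * P)); rewrite QPQ addrC.
Qed.

Lemma projection_isometric V : isometric V -> projection (V * adjoint V).
Proof.
move=> VV; split; first by rewrite adjointM adjointK.
by rewrite mulrA -(mulrA V) VV mulr1.
Qed.

Lemma isometric_mulK V A B : isometric V ->
  adjoint (V * A) * (V * B) = adjoint A * B.
Proof. by move=> VV; rewrite adjointM mulrA -(mulrA _ _ V) VV mulr1. Qed.

(** The rank is left free, so that zero and the rank-one projections are included. *)
Definition coinfinite P := projection P /\ exists2 V, isometric V & P * V = 0.

Lemma infinite_coinfiniteW P : infinite_coinfinite_projection P -> coinfinite P.
Proof. by move=> /infinite_coinfiniteP[pP _ PV]. Qed.

(** The range of [V], inside the kernel of [P], is cut into three pieces: two give [Q1] and [Q2],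
    and the range of [V * c] stays in the kernel of every sum. *)
Lemma coinfinite_split P : coinfinite P -> exists Q1 Q2,
  [/\ infinite_coinfinite_projection Q1,
      infinite_coinfinite_projection Q2
    & infinite_coinfinite_projection (Q1 + Q2)] /\
  [/\ infinite_coinfinite_projection (P + Q1),
      infinite_coinfinite_projection (P + Q2)
    & infinite_coinfinite_projection (P + Q1 + Q2)].
Proof.
move=> [pP [V VV PV]].
have [a [b [c [[aa bb cc] [ab ac bc _]]]]] := exists_cuntz.
have ba : adjoint b * a = 0 by exact: adjoint_mul_eq0 ab.
pose Q1 := V * a * adjoint (V * a); pose Q2 := V * b * adjoint (V * b).
have Va := isometric_mul VV aa; have Vb := isometric_mul VV bb.
have Vc := isometric_mul VV cc.
have p1 : projection Q1 by exact: projection_isometric.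
have p2 : projection Q2 by exact: projection_isometric.
have Q1a : Q1 * (V * a) = V * a by rewrite -mulrA isometric_mulK// aa mulr1.
have Q2b : Q2 * (V * b) = V * b by rewrite -mulrA isometric_mulK// bb mulr1.
have Q1c : Q1 * (V * c) = 0 by rewrite -mulrA isometric_mulK// ac mulr0.
have Q2c : Q2 * (V * c) = 0 by rewrite -mulrA isometric_mulK// bc mulr0.
have Q1b : Q1 * (V * b) = 0 by rewrite -mulrA isometric_mulK// ab mulr0.
have Q2a : Q2 * (V * a) = 0 by rewrite -mulrA isometric_mulK// ba mulr0.
have PT T : P * (V * T) = 0 by rewrite mulrA PV mul0r.
have PQ1 : P * Q1 = 0 by rewrite mulrA PT mul0r.
have PQ2 : P * Q2 = 0 by rewrite mulrA PT mul0r.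
have Q12 : Q1 * Q2 = 0 by rewrite /Q2 mulrA Q1b mul0r.
have icpI A T : projection A -> isometric (V * T) -> A * (V * T) = V * T ->
    A * (V * c) = 0 -> infinite_coinfinite_projection A.
  move=> pA iT AT Ac; apply/infinite_coinfiniteP.
  by split=> //; [exists (V * T) | exists (V * c)].
exists Q1, Q2; split; split.
- exact: (icpI _ a).
- exact: (icpI _ b).
- apply: (icpI _ a) => //; first exact: projectionD.
    by rewrite mulrDl Q1a Q2a addr0.
  by rewrite mulrDl Q1c Q2c addr0.
- apply: (icpI _ a) => //; first exact: projectionD.
    by rewrite mulrDl Q1a PT add0r.
  by rewrite mulrDl Q1c PT addr0.
- apply: (icpI _ b) => //; first exact: projectionD.
    by rewrite mulrDl Q2b PT add0r.
  by rewrite mulrDl Q2c PT addr0.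
- apply: (icpI _ a) => //.
  + apply: projectionD => //; first exact: projectionD.
    by rewrite mulrDl PQ2 Q12 addr0.
  + by rewrite !mulrDl Q1a PT Q2a add0r addr0.
  + by rewrite !mulrDl Q1c PT Q2c !addr0.
Qed.

(** An identity between operators is tested on inner products with arbitrary vectors, where it
    becomes a scalar identity. *)
Ltac bop_field := apply: bop_inner_inj => ? ?;
  rewrite ?bopE ?bop_app ?innerE /=; field.


(** The images of [P + Q1] and [Q2] are orthogonal, and so are those of [Q1] and [Q2], which leaves
    [phi P * phi Q2 = 0]; symmetrically for [Q1]. Hence [phi P], the difference of [phi (P + Q1)]
    and [phi Q1], is a projection whose kernel contains the range of [phi Q1]. *)
Lemma coinfinite_preserved (phi : bop H -> bop H) P :
  {morph phi : A B / A + B} -> (forall Q, infinite_coinfinite_projection Q ->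
             infinite_coinfinite_projection (phi Q)) ->
  coinfinite P -> coinfinite (phi P).
Proof.
move=> phiD phiP cP.
have [Q1 [Q2 [[/phiP i1 /phiP i2 /phiP i12] [/phiP j1 /phiP j2 /phiP j12]]]] :=
  coinfinite_split cP.
move: i12 j1 j2 j12; rewrite !phiD => i12 j1 j2 j12.
have [p1 [V VV Q1V] _] := (infinite_coinfiniteP _).1 i1.
have [p2 _ _] := (infinite_coinfiniteP _).1 i2.
have [p12 _ _] := (infinite_coinfiniteP _).1 i12.
have [r1 _ _] := (infinite_coinfiniteP _).1 j1.
have [r2 _ _] := (infinite_coinfiniteP _).1 j2.
have [r12 _ _] := (infinite_coinfiniteP _).1 j12.
have Q12 := projectionD_orth p1 p2 p12.
have PQ2 : phi P * phi Q2 = 0.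
  by have := projectionD_orth r1 p2 r12; rewrite mulrDl Q12 addr0.
have PQ1 : phi P * phi Q1 = 0.
  have := projectionD_orth r2 p1; rewrite addrAC => /(_ r12).
  by rewrite mulrDl (projection_orthC p1 p2 Q12) addr0.
have aP : adjoint (phi P) = phi P.
  by apply/(addIr (phi Q1)); rewrite -[in LHS](proj1 p1) -adjointD (proj1 r1).
split; last by exists V => //; rewrite -Q1V mulrA PQ1 mul0r.
split=> //; have Q1P : phi Q1 * phi P = 0.
  by rewrite -(proj1 p1) -aP -adjointM PQ1 adjoint0.
apply: (addIr (phi Q1)); rewrite -[RHS](proj2 r1) mulrDl !mulrDr.
by rewrite PQ1 Q1P (proj2 p1) addr0 add0r.
Qed.

Lemma coinfinite_orth_preserved (phi : bop H -> bop H) P Q :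
  {morph phi : A B / A + B} -> (forall Q, infinite_coinfinite_projection Q ->
             infinite_coinfinite_projection (phi Q)) ->
  coinfinite P -> coinfinite Q -> coinfinite (P + Q) -> phi P * phi Q = 0.
Proof.
move=> phiD phiP cP cQ cPQ; apply: projectionD_orth.
- exact: (coinfinite_preserved phiD phiP cP).1.
- exact: (coinfinite_preserved phiD phiP cQ).1.
- by rewrite -phiD; exact: (coinfinite_preserved phiD phiP cPQ).1.
Qed.

(** * The span of the projections of infinite rank and corank *)

(* [X] is the small root (1 - sqrt (1 - 4 S^2)) / 2, reached by iterating
   [X |-> X^2 + S^2]. *)
Lemma exists_quadratic_root S : adjoint S = S ->
  (forall x, `|S x| <= 4^-1 * `|x|) ->
  exists X, [/\ adjoint X = X, X * S = S * X & X * X + S * S = X].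
Proof.
move=> aS SM.
pose F := fix F n : bop H := if n is m.+1 then F m * F m + S * S else 0.
have FS n : F n.+1 = F n * F n + S * S by [].
have q0 : 0 <= 4^-1 :> C by rewrite invr_ge0 ler0n.
have aF n : adjoint (F n) = F n.
  elim: n => [|n IHn]; first exact: adjoint0.
  by rewrite FS adjointD !adjointM IHn aS.
have cF n : F n * S = S * F n.
  elim: n => [|n IHn]; first by rewrite mul0r mulr0.
  by rewrite FS mulrDl mulrDr -(mulrA (F n)) IHn !mulrA IHn.
(* The ball of radius 1/4 is stable under the iteration, since 1/16 + 1/16 <= 1/4. *)
have FM n x : `|F n x| <= 4^-1 * `|x|.
  elim: n x => [|n IHn] x; first by rewrite bop0E normr0 mulr_ge0.
  rewrite FS !bopE (le_trans (ler_normD _ _))//.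
  rewrite (@le_trans _ _ (4^-1 * (4^-1 * `|x|) + 4^-1 * (4^-1 * `|x|)))//.
    by rewrite lerD// (le_trans (IHn _), le_trans (SM _))// ler_wpM2l.
  rewrite -mulrDr ler_wpM2l// -mulrDl ler_piMl//.
  by rewrite (_ : _ + _ = 2^-1); [rewrite invf_le1 ?ler1n|field].
have DM n x : `|(F n.+1 - F n) x| <= 2^-1 ^+ n * `|x|.
  elim: n x => [|n IHn] x.
    by rewrite subr0 mul1r (le_trans (FM _ _))// ler_piMl// invf_le1 ?ler1n.
  (* A difference of squares is split without commutation; each summand has a factor bounded by 1/4,
     so the steps shrink by 1/2. *)
  have -> : F n.+2 - F n.+1 = F n.+1 * (F n.+1 - F n) + (F n.+1 - F n) * F n.
    rewrite (FS n.+1) {3}(FS n) mulrBr mulrBl opprD addrACA subrr addr0.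
    by rewrite addrA subrK.
  rewrite bopDE !bopME (le_trans (ler_normD _ _))//.
  rewrite (@le_trans _ _
    (4^-1 * (2^-1 ^+ n * `|x|) + 2^-1 ^+ n * (4^-1 * `|x|)))//.
    by rewrite lerD// ?(le_trans (FM _ _)) ?(le_trans (IHn _))// ler_wpM2l//
      exprn_ge0// invr_ge0.
  by rewrite exprS le_eqVlt; apply/orP; left; apply/eqP; field.
have F_cvg x : cvgn (F ^~ x).
  rewrite (_ : F ^~ x = series (fun k => (F k.+1 - F k) x)); last first.
    apply/funext => n.
    rewrite -[LHS](_ : (\sum_(0 <= k < n) (F k.+1 - F k)) x = _).
      by rewrite bop_sumE.
    by rewrite telescope_sumr// subr0.
  apply: (@cvg_series_dominated _ _ _ (geometric (complex.Re `|x|) 2^-1)).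
    apply: is_cvg_geometric_series.
    by rewrite ger0_norm ?invr_ge0// invf_lt1 ?ltr1n.
  move=> k; rewrite (le_trans (DM k x))// /geometric /= rmorphM /= rmorphXn /=.
  by rewrite fmorphV /= rmorph_nat RRe_real ?normr_real// mulrC.
have [X XP] := bop_lim FM F_cvg; exists X; split.
- apply: adjoint_unique => x y.
  have := cvg_innerl y (XP x); have := cvg_innerr x (XP y).
  under eq_fun do rewrite adjointPr aF.
  by move=> h1 h2; exact: (cvg_unique _ h2 h1).
- apply: bopP => x; have := cvg_bop S (XP x); have := XP (S x).
  under eq_fun do rewrite -bopME cF bopME.
  by move=> h1 h2; exact: (cvg_unique _ h1 h2).
- apply: bopP => x.
  (* The common bound on [F n] lets [F n (F n x)] be replaced by [F n (X x)] in the limit. *)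
  have w0 : F n (F n x - X x) @[n --> \oo] --> 0.
    apply/cvgrPdist_lt => eps eps0; move/cvgrPdist_lt: (XP x) => /(_ _ eps0).
    apply: filterS => n; apply: le_lt_trans; rewrite sub0r normrN distrC.
    by rewrite (le_trans (FM _ _))// ler_piMl// invf_le1 ?ler1n.
  have h1 : F n.+1 x @[n --> \oo] --> 0 + X (X x) + S (S x).
    rewrite (_ : (fun n => F n.+1 x) =
        (fun n => F n (F n x - X x) + F n (X x) + S (S x))).
      exact: (cvgD (cvgD w0 (XP (X x))) (cvg_cst (S (S x)))).
    by apply/funext => n; rewrite FS !bopE -bop_appD subrK.
  have h2 : F n.+1 x @[n --> \oo] --> X x by rewrite (cvg_shiftS (F ^~ x)).
  by rewrite !bopE -[X (X x)]add0r; exact: (cvg_unique _ h1 h2).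
Qed.

(** [T] carries no block: its range is a reserve that keeps block projections along [V] and [W]
    coinfinite. *)
Definition orthogonal_isometries V W T :=
  [/\ isometric V, isometric W & isometric T] /\
  [/\ adjoint V * W = 0, adjoint V * T = 0 & adjoint W * T = 0].

(* [A] is the infinite ampliation of [S]: the sum over [n] of
   [W^n V S (W^n V)^*]. *)
Lemma exists_ampliation V W S : isometric V -> isometric W ->
  adjoint V * W = 0 -> exists A, A = V * S * adjoint V + W * A * adjoint W.
Proof.
move=> VV WW VW; pose B n : bop H := W ^+ n * V.
have B0 : B 0%N = V by rewrite /B expr0 mul1r.
have BS n : B n.+1 = W * B n by rewrite /B exprS mulrA.
have WV : adjoint W * V = 0 by exact: adjoint_mul_eq0 VW.
have BB i j : adjoint (B i) * B j = (i == j)%:R.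
  elim: i j => [|i IHi] [|j].
  - by rewrite /B !expr0 !mul1r VV.
  - by rewrite BS /B expr0 mul1r mulrA VW mul0r.
  - by rewrite BS /B expr0 mul1r adjointM -mulrA WV mulr0.
  - by rewrite !BS adjointM -mulrA (mulrA (adjoint W)) WW mul1r IHi.
(* Bessel's inequality for two blocks: [u] is the orthogonal projection of [x] onto the sum of the
   ranges of [V] and [W]. *)
have VWx x : `|adjoint V x| ^+ 2 + `|adjoint W x| ^+ 2 <= `|x| ^+ 2.
  pose u := V (adjoint V x) + W (adjoint W x).
  have Vu : adjoint V u = adjoint V x.
    by rewrite bop_appD -!(bopME (adjoint V)) VV VW bop0E addr0.
  have Wu : adjoint W u = adjoint W x.
    by rewrite bop_appD -!(bopME (adjoint W)) WW WV bop0E add0r.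
  have uE y : inner y u = inner (adjoint V y) (adjoint V x) +
      inner (adjoint W y) (adjoint W x) by rewrite innerDr !adjointPr.
  have xu : inner (x - u) u = 0.
    by rewrite innerDl innerNl !uE Vu Wu subrr.
  have -> : `|adjoint V x| ^+ 2 + `|adjoint W x| ^+ 2 = `|u| ^+ 2.
    by rewrite -(inner_norm u) uE Vu Wu !inner_norm.
  by have := norm_orthD xu; rewrite subrK => ->; rewrite lerDr exprn_ge0.
have sumB n x : \sum_(0 <= k < n) `|adjoint (B k) x| ^+ 2 <= `|x| ^+ 2.
  elim: n x => [|n IHn] x; first by rewrite big_nil exprn_ge0.
  rewrite big_nat_recl// (le_trans _ (VWx x))// B0 lerD2l.
  rewrite (le_trans _ (IHn (adjoint W x)))// ler_sum// => k _.
  by rewrite BS adjointM.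
have [M M0 SM] := bop_bound S.
have [|n x|A AP] := @sum_bop_cvg (fun k => B k * S * adjoint (B k)) M M0.
- move=> i j x y ij; rewrite -!mulrA !(bopME (B _)) adjointP -bopME.
  by rewrite BB (negbTE ij) bop0E inner0r.
- rewrite exprMn (le_trans _ (ler_wpM2l _ (sumB n x))) ?exprn_ge0//.
  rewrite mulr_sumr ler_sum// => k _; rewrite -mulrA -inner_norm.
  rewrite bopME adjointP -bopME BB eqxx inner_norm -exprMn.
  by rewrite ler_pXn2r ?nnegrE ?mulr_ge0// bopME SM.
exists A; apply: bopP => x.
(* The shifted index splits off the term of index 0, [V * S * adjoint V]; the other terms are those
   of [A] conjugated by [W]. *)
have h1 :
    series (fun k => (B k * S * adjoint (B k)) x) n.+1 @[n --> \oo] --> A x.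
  by rewrite (cvg_shiftS (series _)).
have h2 : series (fun k => (B k * S * adjoint (B k)) x) n.+1 @[n --> \oo] -->
    (V * S * adjoint V) x + W (A (adjoint W x)).
  rewrite (_ : (fun n => _) = (fun n => (V * S * adjoint V) x +
    W (series (fun k => (B k * S * adjoint (B k)) (adjoint W x)) n))).
    exact: (cvgD (cvg_cst _) (cvg_bop W (AP (adjoint W x)))).
  apply/funext => n; rewrite /series /= big_nat_recl// B0 bop_app_sum.
  by congr (_ + _); apply: eq_bigr => k _; rewrite BS adjointM exprS.
exact: (cvg_unique _ h1 h2).
Qed.

(** * Block operators in the span *)

Section span.
(** An arbitrary subspace containing the projections stands for their span, which turns [span_full]
    into an induction principle for linear statements about operators. *)
Variable L : bop H -> Prop.
Hypothesis LD : forall A B, L A -> L B -> L (A + B).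
Hypothesis LZ : forall a A, L A -> L (a *: A).
Hypothesis L_proj : forall P, infinite_coinfinite_projection P -> L P.

Lemma span_opp A : L A -> L (- A).
Proof. by move=> LA; rewrite -scaleN1r; exact: LZ. Qed.

Lemma span_scaled a A : a != 0 -> L (a *: A) -> L A.
Proof. by move=> a0 /(@LZ a^-1); rewrite scalerA mulVf// scale1r. Qed.

Lemma span_coinfinite P : coinfinite P -> L P.
Proof.
move=> /coinfinite_split[Q [_ [[/L_proj LQ _ _] [/L_proj LPQ _ _]]]].
by rewrite -(addrK Q P); apply: LD => //; exact: span_opp.
Qed.

(** [P a] is the block projection whose off-diagonal entries carry the phase [a] and its conjugate.
    The diagonal cancels in [P a - P (- a)], and the phases 1 and ['i] separate the two off-diagonal
    blocks. *)
Lemma span_offdiag_small V W T S : orthogonal_isometries V W T ->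
  adjoint S = S -> (forall x, `|S x| <= 4^-1 * `|x|) -> L (V * S * adjoint W).
Proof.
move=> [[VV WW TT] [VW VT WT]] aS SM.
have WV : adjoint W * V = 0 by exact: adjoint_mul_eq0 VW.
have [X [aX cX XE]] := exists_quadratic_root aS SM.
pose P a : bop H := V * (X * adjoint V + a *: (S * adjoint W)) +
  W * (a^* *: (S * adjoint V) + (1 - X) * adjoint W).
have VP a : adjoint V * P a = X * adjoint V + a *: (S * adjoint W).
  by rewrite mulrDr !(mulrA (adjoint V)) VV VW mul1r mul0r addr0.
have WP a : adjoint W * P a = a^* *: (S * adjoint V) + (1 - X) * adjoint W.
  by rewrite mulrDr !(mulrA (adjoint W)) WW WV mul1r mul0r add0r.
have LP a : a * a^* = 1 -> L (P a).
  move=> aa; apply: span_coinfinite; split; last first.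
    exists T => //; rewrite mulrDl -!mulrA !mulrDl -!bop_scaleAl -!mulrA VT WT.
    by rewrite !mulr0 !scaler0 !addr0 !mulr0 addr0.
  have a0 : a != 0.
    by apply/eqP => a0; move/eqP: aa; rewrite a0 mul0r eq_sym oner_eq0.
  have aV : a^* = a^-1 by apply: (mulfI a0); rewrite aa divff.
  split; first by rewrite /P !adjointE aX aS conjCK; bop_field.
  have XX x : X (X x) = X x - S (S x) by rewrite -[in RHS]XE !bopE addrK.
  have XS x : X (S x) = S (X x) by rewrite -!bopME cX.
  rewrite {1}/P mulrDl -!mulrA !mulrDl -!bop_scaleAl -!mulrA VP WP aV.
  by congr (_ * _ + _ * _); apply: bop_inner_inj => x y;
    rewrite !bopE !bop_app !(XX, XS) ?bop_app !innerE ?aV; field.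
pose A1 := V * S * adjoint W; pose A2 := W * S * adjoint V.
have E a : P a - P (- a) = 2 *: (a *: A1 + a^* *: A2).
  by rewrite /P rmorphN; bop_field.
have L0 a : a * a^* = 1 -> L (a *: A1 + a^* *: A2).
  move=> aa; apply: (@span_scaled 2); first by rewrite pnatr_eq0.
  rewrite -E; apply: LD; first exact: LP.
  by apply: span_opp; apply: LP; rewrite rmorphN mulrNN.
have L1 : L (1 *: A1 + 1 *: A2).
  by have := L0 1; rewrite conjC1 mulr1; apply.
have L2 : L ('i *: A1 + - 'i *: A2).
  by have := L0 'i; rewrite conjCi mulrN -expr2 sqrCi opprK; apply.
apply: (@span_scaled 2); first by rewrite pnatr_eq0.
rewrite (_ : 2 *: _ = (1 *: A1 + 1 *: A2) + - 'i *: ('i *: A1 + - 'i *: A2)).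
  by apply: LD => //; exact: LZ.
rewrite scalerDr !scalerA mulrNN mulNr -expr2 sqrCi opprK.
by rewrite -/A1; bop_field.
Qed.

Lemma span_offdiag_selfadjoint V W T S : orthogonal_isometries V W T ->
  adjoint S = S -> L (V * S * adjoint W).
Proof.
move=> VWT aS; have [M M0 SM] := bop_bound S.
(* Dividing by this number makes [S] small; the summand 1 keeps it positive when [M] is 0. *)
have M1 : 0 < 4 * (M + 1) by rewrite mulr_gt0// ltr_wpDl.
have M1r : 4 * (M + 1) \is Num.real by rewrite gtr0_real.
apply: (@span_scaled (4 * (M + 1))^-1); first by rewrite invr_neq0 ?gt_eqF.
rewrite bop_scaleAl bop_scaleAr; apply: (span_offdiag_small VWT).
  by rewrite adjointZ aS conj_Creal ?rpredV.
move=> x; rewrite bopZE normrZ gtr0_norm ?invr_gt0// invfM -mulrA.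
rewrite ler_wpM2l ?invr_ge0// ler_pdivrMl ?ltr_wpDl//.
by rewrite (le_trans (SM x))// ler_wpM2r// lerDl.
Qed.

Lemma span_offdiag V W T S : orthogonal_isometries V W T ->
  L (V * S * adjoint W).
Proof.
move=> VWT; apply: (@span_scaled 2); first by rewrite pnatr_eq0.
(* The self-adjoint and skew-adjoint parts of [S], the latter made self-adjoint by the factor
   ['i]. *)
have -> : 2 *: (V * S * adjoint W) = V * (S + adjoint S) * adjoint W -
    'i *: (V * ('i *: (S - adjoint S)) * adjoint W).
  rewrite -bop_scaleAr -bop_scaleAl scalerA -expr2 sqrCi scaleN1r opprK.
  by bop_field.
apply: LD; first apply: (span_offdiag_selfadjoint VWT).
  by rewrite adjointD adjointK addrC.
apply/span_opp/LZ/(span_offdiag_selfadjoint VWT).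
by rewrite adjointZ adjointD adjointN adjointK conjCi scaleNr -scalerN opprB.
Qed.

(* Rotating [V] and [W] by a rational angle turns off-diagonal blocks into
   combinations of diagonal and off-diagonal ones. *)
Lemma span_diag_sub V W T S : orthogonal_isometries V W T ->
  L (V * S * adjoint V - W * S * adjoint W).
Proof.
move=> VWT; have [[VV WW TT] [VW VT WT]] := VWT.
have WV : adjoint W * V = 0 by exact: adjoint_mul_eq0 VW.
have WVT : orthogonal_isometries W V T by [].
pose V' := (3 / 5) *: V + (4 / 5) *: W; pose W' := (4 / 5) *: V - (3 / 5) *: W.
have cR (m n : nat) : (m%:R / n%:R)^* = m%:R / n%:R :> C.
  by rewrite rmorphM fmorphV !rmorph_nat.
have V'W'T : orthogonal_isometries V' W' T.
  by split; split=> //; rewrite /isometric ?/V' ?/W' !adjointE ?cR !mulrDl;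
    rewrite ?mulrDr ?mulNr ?mulrN -?bop_scaleAl -?bop_scaleAr;
    rewrite ?VV ?WW ?VW ?WV ?VT ?WT; bop_field.
(* Here the diagonal blocks have coefficients 12/25 and -12/25, the off-diagonal ones -9/25 and
   16/25; [L2] and [L3] remove the latter. *)
have L1 := span_offdiag S V'W'T.
have L2 := LZ (9 / 25) (span_offdiag S VWT).
have L3 := LZ (16 / 25) (span_offdiag S WVT).
apply: (@span_scaled (12 / 25)).
  by rewrite mulf_neq0 ?invr_eq0 ?pnatr_eq0.
have := LD (LD L1 L2) (span_opp L3).
rewrite [X in L X -> _](_ : _ =
  (12 / 25) *: (V * S * adjoint V - W * S * adjoint W))//.
by rewrite /V' /W' !adjointE !cR; bop_field.
Qed.

(** For the ampliation [A] of [S], the differences along [V], [W] and along [V * W], [W] subtract to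
    [V * (A - W * A * adjoint W) * adjoint V], the block of [S] along [V * V]. One more difference
    moves this block to [W], and another one to [V]. *)
Lemma span_corner V W T S : orthogonal_isometries V W T ->
  L (V * S * adjoint V).
Proof.
move=> VWT; have [[VV WW TT] [VW VT WT]] := VWT.
have [A AE] := exists_ampliation S VV WW VW.
have iM B : isometric B -> orthogonal_isometries (V * B) W T.
  move=> BB; split; split=> //; first exact: isometric_mul.
    by rewrite adjointM -mulrA VW mulr0.
  by rewrite adjointM -mulrA VT mulr0.
have LVV : L (V * V * S * adjoint (V * V)).
  have := LD (span_diag_sub A VWT) (span_opp (span_diag_sub A (iM W WW))).
  rewrite [X in L X -> _](_ : _ = V * V * S * adjoint (V * V))//.
  rewrite opprB addrA subrK -[V * A]/(V * A) {1}AE !adjointM.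
  by rewrite !mulrDr !mulrDl !mulrA addrK.
have LW : L (W * S * adjoint W).
  have := LD LVV (span_opp (span_diag_sub S (iM V VV))).
  by rewrite opprB addrC subrK.
by have := LD (span_diag_sub S VWT) LW; rewrite subrK.
Qed.

Theorem span_full A : L A.
Proof.
have [a [b [c [[aa bb cc] [ab ac bc abc]]]]] := exists_cuntz.
have ba : adjoint b * a = 0 by exact: adjoint_mul_eq0 ab.
have ca : adjoint c * a = 0 by exact: adjoint_mul_eq0 ac.
have cb : adjoint c * b = 0 by exact: adjoint_mul_eq0 bc.
(* [A] becomes a 3 by 3 block matrix; for each block, an isometry outside it serves as the
   reserve. *)
rewrite -[A]mul1r -[A in 1 * A]mulr1 -abc.
have E V W : V * adjoint V * (A * (W * adjoint W)) =
    V * (adjoint V * A * W) * adjoint W by rewrite !mulrA.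
rewrite !mulrDl !mulrDr !E.
have o1 : orthogonal_isometries a b c by [].
have o2 : orthogonal_isometries a c b by [].
have o3 : orthogonal_isometries b a c by [].
have o4 : orthogonal_isometries b c a by [].
have o5 : orthogonal_isometries c a b by [].
have o6 : orthogonal_isometries c b a by [].
by do ![apply: LD];
  first [ exact: (span_corner _ o1) | exact: (span_corner _ o3)
        | exact: (span_corner _ o5) | exact: (span_offdiag _ o1)
        | exact: (span_offdiag _ o2) | exact: (span_offdiag _ o3)
        | exact: (span_offdiag _ o4) | exact: (span_offdiag _ o5)
        | exact: (span_offdiag _ o6) ].
Qed.

End span.

(** * Images of rank-one operators *)

(* [V] maps [e n] into the span of [e (2 n)] and [e (2 n + 1)]. *)
Lemma exists_isometric_orth x :
  exists2 V : bop H, isometric V & adjoint V x = 0.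
Proof.
have oe := basis_orthonormal.
(* Unit coefficients that make a combination of two neighbouring basis vectors orthogonal to [x]. *)
have sol (p q : C) : exists ab : C * C,
    ab.1 * ab.1^* + ab.2 * ab.2^* = 1 /\ ab.1 * p + ab.2 * q = 0.
  have [/eqP|pq0] := eqVneq (`|p| ^+ 2 + `|q| ^+ 2) 0.
    rewrite paddr_eq0 ?exprn_ge0// !sqrf_eq0 !normr_eq0 => /andP[/eqP-> /eqP->].
    exists (1, 0).
    by split; rewrite /= ?conjC1 ?conjC0 ?mulr0 ?addr0 ?mulr1 ?mulr0.
  set n := `|p| ^+ 2 + `|q| ^+ 2 in pq0; pose s := sqrtC n.
  have n0 : 0 <= n by rewrite addr_ge0 ?exprn_ge0.
  have sR : s^* = s by rewrite conj_Creal// ger0_real// sqrtC_ge0.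
  have ss : s * s = n by rewrite -expr2 sqrtCK.
  have s0 : s != 0 by rewrite sqrtC_eq0.
  exists (q / s, - p / s) => /=; split; last by field.
  rewrite !rmorphM !fmorphV !rmorphN /= sR.
  rewrite (_ : _ + _ = (p * p^* + q * q^*) / (s * s)); last by field.
  by rewrite -!normCK ss divff.
have /choice[g gP] := fun n =>
  sol (inner (e (2 * n)%N) x) (inner (e (2 * n + 1)%N) x).
pose f n := (g n).1 *: e (2 * n)%N + (g n).2 *: e (2 * n + 1)%N.
have of_ : orthonormal_seq f.
  move=> i j; rewrite /f !innerE !oe eqn_add2r eqn_mul2l /=.
  have -> : (2 * i == 2 * j + 1)%N = false by apply/negP => /eqP; lia.
  have -> : (2 * i + 1 == 2 * j)%N = false by apply/negP => /eqP; lia.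
  have [->|_] := eqVneq i j; last first.
    by rewrite !(mulr0n, mulr0, addr0).
  by rewrite !(mulr0n, mulr0, mulr1, addr0, add0r) (gP j).1.
have [V [VV Vf]] := exists_isometric of_; exists V => //.
apply: basis_inj => i; rewrite inner0l -adjointPr Vf; apply: inner_eq0.
by rewrite !innerE (gP i).2.
Qed.

Lemma projection_rank_one x : inner x x = 1 -> projection (rank_one x x).
Proof.
move=> xx; split; rewrite ?adjoint_rank_one//.
by rewrite mul_rank_one rank_oneE xx scale1r.
Qed.

(** [V] maps into the kernel of [P]; composing it with an isometry whose range is orthogonal to
    [adjoint V x] makes its range orthogonal to [x] too. *)
Lemma coinfiniteD_rank_one P x : coinfinite P -> inner x x = 1 -> P x = 0 ->
  coinfinite (P + rank_one x x).
Proof.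
move=> [pP [V VV PV]] xx Px.
have [W WW Wx] := exists_isometric_orth (adjoint V x).
split; last first.
  exists (V * W); first exact: isometric_mul.
  rewrite mulrDl mulrA PV mul0r add0r rank_one_mul adjointM bopME Wx.
  by apply: bopP => z; rewrite !bopE inner0r scale0r.
apply: projectionD => //; first exact: projection_rank_one.
by rewrite mul_rank_one Px rank_one0l.
Qed.

Lemma coinfinite_rank_one x : inner x x = 1 -> coinfinite (rank_one x x).
Proof.
move=> xx; rewrite -[rank_one x x]add0r; apply: coinfiniteD_rank_one => //.
split; first by split; rewrite ?adjoint0 ?mul0r.
by exists 1; rewrite /isometric ?adjoint1 ?mul1r ?mul0r.
Qed.

Lemma coinfiniteB_rank_one P x : coinfinite P -> inner x x = 1 -> P x = x ->
  coinfinite (P - rank_one x x).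
Proof.
move=> [pP [V VV PV]] xx Px; split; last first.
  exists V => //; rewrite mulrBl PV sub0r rank_one_mul -Px -(proj1 pP) -bopME.
  rewrite -adjointM PV adjoint0 (proj1 pP) Px.
  by apply: bopP => z; rewrite !bopE inner0r scale0r oppr0.
apply: projectionB => //; first exact: projection_rank_one.
by rewrite mul_rank_one Px.
Qed.

Lemma exists_unit x : x != 0 -> exists2 y, inner y y = 1 & x = `|x| *: y.
Proof.
move=> x0; exists (`|x|^-1 *: x); last first.
  by rewrite scalerA divff ?scale1r ?normr_eq0.
rewrite !innerE inner_norm conj_Creal ?rpredV ?normr_real//.
by rewrite expr2 mulKf ?mulVf ?normr_eq0.
Qed.

(* The Pythagorean triple 3, 4, 5 supplies enough rational points of the unit
   circle to separate the coefficients. *)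
Lemma pythagorean_projections P Q Z : projection P -> projection Q ->
  P * Q = 0 ->
  (forall c s : C, c * c + s * s = 1 -> c^* = c -> s^* = s ->
    let R := (c * c) *: P + (s * s) *: Q + (c * s) *: Z in R * R = R) ->
  [/\ Z * Z = P + Q, P * Z + Z * P = Z & Q * Z + Z * Q = Z].
Proof.
move=> pP pQ PQ0 HR; have QP0 := projection_orthC pP pQ PQ0.
have PP x : P (P x) = P x by rewrite -bopME (proj2 pP).
have QQ x : Q (Q x) = Q x by rewrite -bopME (proj2 pQ).
have PQ x : P (Q x) = 0 by rewrite -bopME PQ0.
have QP x : Q (P x) = 0 by rewrite -bopME QP0.
have c3 : (3 / 5)^* = 3 / 5 :> C by rewrite rmorphM fmorphV !rmorph_nat.
have c4 : (4 / 5)^* = 4 / 5 :> C by rewrite rmorphM fmorphV !rmorph_nat.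
have c3N : (- (3 / 5))^* = - (3 / 5) :> C by rewrite rmorphN /= c3.
have c4N : (- (4 / 5))^* = - (4 / 5) :> C by rewrite rmorphN /= c4.
pose rho (c s : C) :=
  let R := (c * c) *: P + (s * s) *: Q + (c * s) *: Z in R * R - R.
have rho1 : rho (3 / 5) (4 / 5) = 0.
  by apply/eqP; rewrite subr_eq0 HR//; field.
have rho2 : rho (3 / 5) (- (4 / 5)) = 0.
  by apply/eqP; rewrite subr_eq0 HR//; field.
have rho3 : rho (4 / 5) (3 / 5) = 0.
  by apply/eqP; rewrite subr_eq0 HR//; field.
have rho4 : rho (4 / 5) (- (3 / 5)) = 0.
  by apply/eqP; rewrite subr_eq0 HR//; field.
have {PP QQ PQ QP HR} rhoE c s : rho c s =
    (c * c * (c * c) - c * c) *: P + (s * s * (s * s) - s * s) *: Q +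
    (c * c * (c * s)) *: (P * Z + Z * P) +
    (s * s * (c * s)) *: (Q * Z + Z * Q) +
    (c * s * (c * s)) *: (Z * Z) - (c * s) *: Z.
  rewrite /rho; apply: bop_inner_inj => x y.
  by rewrite !bopE !bop_app ?(PP, QQ, PQ, QP) !innerE; ring.
move: rho1 rho2 rho3 rho4; rewrite !rhoE {rho rhoE}.
move: (P * Z + Z * P) (Q * Z + Z * Q) (Z * Z) => A B D rho1 rho2 rho3 rho4.
split; apply/eqP; rewrite -subr_eq0; apply/eqP.
(* Adding the relations for opposite [s] cancels the terms odd in [s]. *)
- have := congr1 ( *:%R (625 / 288 : C)) (congr2 +%R rho1 rho2).
  by rewrite addr0 scaler0 => <-; bop_field.
(* Differences keep only the odd terms. The two pairs form a 2 by 2 linear system, solved here for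
   one unknown and next for the other. *)
- have := congr2 (fun A B => (- 75 / 56 : C) *: A + (50 / 21 : C) *: B)
    (congr2 (fun A B => A - B) rho1 rho2) (congr2 (fun A B => A - B) rho3 rho4).
  by rewrite subr0 !scaler0 addr0 => <-; bop_field.
- have := congr2 (fun A B => (50 / 21 : C) *: A + (- 75 / 56 : C) *: B)
    (congr2 (fun A B => A - B) rho1 rho2) (congr2 (fun A B => A - B) rho3 rho4).
  by rewrite subr0 !scaler0 addr0 => <-; bop_field.
Qed.

(** The relations yield [P * Z = P * (Z * Q)] and [Z * P = Q * (Z * P)]: only the off-diagonal
    corners survive. *)
Lemma offdiag_rank_one x y Z : inner x x = 1 -> inner y y = 1 ->
  inner x y = 0 ->
  rank_one x x * Z + Z * rank_one x x = Z ->
  rank_one y y * Z + Z * rank_one y y = Z ->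
  Z = inner (Z y) x *: rank_one x y + inner (Z x) y *: rank_one y x.
Proof.
move=> xx yy xy; set P := rank_one x x; set Q := rank_one y y => PZ QZ.
have PQ : P * Q = 0.
  by rewrite mul_rank_one rank_oneE inner_eq0// scale0r rank_one0l.
have QP : Q * P = 0 by rewrite mul_rank_one rank_oneE xy scale0r rank_one0l.
have PZQ : P * Z = P * (Z * Q) by rewrite -{1}QZ mulrDr mulrA PQ mul0r add0r.
have ZPQ : Z * P = Q * (Z * P) by rewrite -{1}QZ mulrDl -!mulrA QP mulr0 addr0.
rewrite -{1}PZ PZQ ZPQ !mul_rank_one !rank_oneE.
by rewrite !rank_oneZl.
Qed.

Lemma rank_one_neq0 x : inner x x = 1 -> rank_one x x != 0.
Proof.
move=> xx; apply/eqP => /(congr1 (fun A : bop H => inner (A x) x)).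
by rewrite rank_oneE xx scale1r xx bop0E inner0l => /eqP; rewrite oner_eq0.
Qed.

(** A unit vector [y] in the range of [phi p] splits off [rank_one y y]. Pulled back by [psi], this
    is a projection [q] below the minimal projection [p], hence a multiple of [p]; being idempotent
    and nonzero, it equals [p]. *)
Lemma rank_one_preserved (phi psi : bop H -> bop H) x :
  cancel phi psi -> cancel psi phi -> {morph phi : A B / A + B} ->
  (forall P, coinfinite P -> coinfinite (phi P)) ->
  (forall P, coinfinite P -> coinfinite (psi P)) -> inner x x = 1 ->
  exists2 y, inner y y = 1 & phi (rank_one x x) = rank_one y y.
Proof.
move=> phiK psiK phiD phi_co psi_co xx; set p := rank_one x x.
have phi0 : phi 0 = 0 by apply: (addIr (phi 0)); rewrite -phiD !add0r.
have psiD : {morph psi : A B / A + B}.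
  by move=> A B; apply: (can_inj phiK); rewrite phiD !psiK.
have cp : coinfinite p by exact: coinfinite_rank_one.
have [[ap pp] _] := cp.
have [z rz] : exists z, phi p z != 0.
  apply: contrapT => /forallNP rz; have := rank_one_neq0 xx; rewrite -/p.
  suff : phi p = phi 0 by move=> /(can_inj phiK) ->; rewrite eqxx.
  rewrite phi0; apply: bopP => z; apply/eqP.
  by rewrite bop0E -[_ == 0]negbK; apply/negP/rz.
have cr := phi_co _ cp; have [[ar rr] _] := cr.
have [y yy zE] := exists_unit rz.
have ry : phi p y = y.
  have nz : `|phi p z| != 0 by rewrite normr_eq0.
  by apply: (scalerI nz); rewrite -bop_appZ -zE -bopME rr.
exists y => //; set q := psi (rank_one y y).
have cq : coinfinite q.
  by apply: psi_co; exact: coinfinite_rank_one.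
have [[aq qq] _] := cq.
have cs : coinfinite (psi (phi p - rank_one y y)).
  by apply: psi_co; exact: coinfiniteB_rank_one.
have pE : q + psi (phi p - rank_one y y) = p.
  by rewrite -psiD addrC subrK phiK.
have qs : q * psi (phi p - rank_one y y) = 0.
  by apply: projectionD_orth; [exact: cq.1|exact: cs.1|rewrite pE; exact: cp.1].
have qp : q * p = q by rewrite -pE mulrDr qs addr0 qq.
have pq : p * q = q by rewrite -{1}aq -{1}ap -adjointM qp.
pose l := inner (q x) x.
have qx : q x = l *: x by rewrite -{1}pq bopME rank_oneE.
have qE : q = l *: p by rewrite -[LHS]qp mul_rank_one qx rank_oneZl.
have q0 : q != 0.
  apply/eqP => /(congr1 phi); rewrite psiK phi0 => /eqP.
  by apply/negP; exact: rank_one_neq0.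
have : (l * l - l) *: p = 0.
  apply/eqP; rewrite scalerBl -scalerA -qE subr_eq0; apply/eqP.
  by rewrite -[RHS]qq [X in q * X]qE -bop_scaleAr qp.
move/eqP; rewrite scaler_eq0 (negbTE (rank_one_neq0 xx)) orbF subr_eq0.
move=> /eqP ll; have l0 : l != 0.
  by apply: contraNneq q0 => l0; rewrite qE l0 scale0r.
have l1 : l = 1 by apply: (mulfI l0); rewrite ll mulr1.
by rewrite -(psiK (rank_one y y)) -/q qE l1 scale1r.
Qed.

(** * Images of the operators [rank_one v u] and construction of the unitary *)

Section preserver.
Variables phi psi : bop H -> bop H.
Hypothesis phiK : cancel phi psi.
Hypothesis psiK : cancel psi phi.
Hypothesis phiD : {morph phi : A B / A + B}.
Hypothesis phiZ : forall a, {morph phi : A / a *: A}.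
Hypothesis phi_proj : forall P, infinite_coinfinite_projection P <->
  infinite_coinfinite_projection (phi P).

Lemma preserver0 : phi 0 = 0.
Proof. by rewrite -[in LHS](scale0r (0 : bop H)) phiZ scale0r. Qed.

Lemma preserverN A : phi (- A) = - phi A.
Proof. by rewrite -[- A]scaleN1r phiZ scaleN1r. Qed.

Lemma inverse_preserverD : {morph psi : A B / A + B}.
Proof. by move=> A B; apply: (can_inj phiK); rewrite phiD !psiK. Qed.

Lemma preserver_coinfinite P : coinfinite P -> coinfinite (phi P).
Proof. by apply: coinfinite_preserved => // Q /phi_proj. Qed.

Lemma inverse_preserver_coinfinite P : coinfinite P -> coinfinite (psi P).
Proof.
apply: coinfinite_preserved; first exact: inverse_preserverD.
by move=> Q icQ; apply/phi_proj; rewrite psiK.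
Qed.

Lemma preserver_orth P Q : coinfinite P -> coinfinite Q -> coinfinite (P + Q) ->
  phi P * phi Q = 0.
Proof. by apply: coinfinite_orth_preserved => // Q' /phi_proj. Qed.

Lemma preserver_rank_one x : inner x x = 1 ->
  exists2 y, inner y y = 1 & phi (rank_one x x) = rank_one y y.
Proof.
exact: (rank_one_preserved phiK psiK phiD preserver_coinfinite
  inverse_preserver_coinfinite).
Qed.

Lemma inverse_preserver_rank_one x : inner x x = 1 ->
  exists2 y, inner y y = 1 & psi (rank_one x x) = rank_one y y.
Proof.
exact: (rank_one_preserved psiK phiK inverse_preserverD
  inverse_preserver_coinfinite preserver_coinfinite).
Qed.

Variables u f : H.
Hypothesis uu : inner u u = 1.
Hypothesis ff : inner f f = 1.
Hypothesis phi_u : phi (rank_one u u) = rank_one f f.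

(** For unimodular [t], the projections onto the vectors [c *: u + (s * t) *: v] show that [Z t] is
    self-adjoint, off-diagonal and squares to [P + Q]. The phases 1 and ['i] recover [X] and [Y];
    three phases together give the conditions on [a] and [b]. *)
Lemma preserver_offdiag v : inner v v = 1 -> inner v u = 0 ->
  exists y (a b : C),
  [/\ inner y y = 1, inner y f = 0, a * b = 0 & a * a^* + b * b^* = 1] /\
  [/\ phi (rank_one v v) = rank_one y y,
      phi (rank_one v u) = a *: rank_one f y + b *: rank_one y f
    & phi (rank_one u v) = a^* *: rank_one y f + b^* *: rank_one f y].
Proof.
move=> vv vu; have uv := inner_eq0 vu.
have [y yy phi_v] := preserver_rank_one vv.
have cu := coinfinite_rank_one uu; have cv := coinfinite_rank_one vv.
have cuv : coinfinite (rank_one u u + rank_one v v).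
  by apply: coinfiniteD_rank_one => //; rewrite rank_oneE vu scale0r.
set P := rank_one f f; set Q := rank_one y y in phi_v.
have PQ : P * Q = 0 by have := preserver_orth cu cv cuv; rewrite phi_u phi_v.
have pP : projection P by exact: projection_rank_one.
have pQ : projection Q by exact: projection_rank_one.
have yf : inner y f = 0.
  have := congr1 (fun A : bop H => inner (A y) f) PQ.
  by rewrite bopME !rank_oneE yy scale1r innerZl ff mulr1 bop0E inner0l.
have fy := inner_eq0 yf.
set X := phi (rank_one v u); set Y := phi (rank_one u v).
pose Z (t : C) := t *: X + t^* *: Y.
have conjq (m n : nat) : (m%:R / n%:R)^* = m%:R / n%:R :> C.
  by rewrite rmorphM fmorphV !rmorph_nat.
have HR (t c s : C) : t * t^* = 1 -> c * c + s * s = 1 -> c^* = c -> s^* = s ->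
    projection ((c * c) *: P + (s * s) *: Q + (c * s) *: Z t).
  move=> tt cs cc ss; pose w := c *: u + (s * t) *: v.
  have ww : inner w w = 1.
    rewrite /w !innerE uu vv uv vu rmorphM /= cc ss.
    rewrite (_ : _ + _ = c * c + s * s * (t * t^*)); last by ring.
    by rewrite tt mulr1.
  have := (preserver_coinfinite (coinfinite_rank_one ww)).1.
  rewrite [X in projection X -> _](_ : _ =
    (c * c) *: P + (s * s) *: Q + (c * s) *: Z t)//.
  rewrite /w rank_oneDl !rank_oneDr !rank_oneZl !rank_oneZr !phiD !phiZ.
  rewrite phi_u phi_v rmorphM /= cc ss -/X -/Y -/P /Z.
  have t0 : t != 0.
    by apply/eqP => t0; move/eqP: tt; rewrite t0 mul0r eq_sym oner_eq0.
  have -> : t^* = t^-1 by apply: (mulfI t0); rewrite tt divff.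
  by bop_field.
have aZ t : t * t^* = 1 -> adjoint (Z t) = Z t.
  move=> tt; move: (Z t) (HR t (3 / 5) (4 / 5) tt) => Zt; rewrite !conjq.
  case=> //; first by field.
  rewrite !adjointD !adjointZ !rmorphM /= !fmorphV !rmorph_nat.
  rewrite (proj1 pP) (proj1 pQ).
  move=> /addrI E _; have k0 : 3 / 5 * (4 / 5) != 0 :> C.
    by rewrite !mulf_neq0 ?invr_eq0 ?pnatr_eq0.
  exact: (scalerI k0 E).
have ZE t : t * t^* = 1 -> Z t * Z t = P + Q /\
    Z t = inner (Z t y) f *: rank_one f y + inner (Z t f) y *: rank_one y f.
  move=> tt; have [|ZZ PZ QZ] := @pythagorean_projections P Q (Z t) pP pQ PQ.
    by move=> c s cs cc ss /=; exact: (HR t c s tt cs cc ss).2.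
  by split=> //; exact: offdiag_rank_one.
have t1 : 1 * 1^* = 1 :> C by rewrite conjC1 mulr1.
have ti : 'i * 'i^* = 1 :> C by rewrite conjCi mulrN -expr2 sqrCi opprK.
have ZiE : Z 'i = 'i *: (X - Y).
  by rewrite /Z conjCi scaleNr scalerBr.
have XE : X = 2^-1 *: Z 1 + (- 'i / 2) *: Z 'i.
  rewrite ZiE scalerA mulrAC mulNr -expr2 sqrCi opprK /Z conjC1.
  by bop_field.
have YE : Y = adjoint X.
  rewrite XE adjointD !adjointZ !aZ// rmorphM rmorphN /= conjCi opprK.
  rewrite fmorphV rmorph_nat ZiE scalerA mulrAC -expr2 sqrCi /Z conjC1.
  by bop_field.
pose F A : bop H :=
  inner (A y) f *: rank_one f y + inner (A f) y *: rank_one y f.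
have FD k l A B : F (k *: A + l *: B) = k *: F A + l *: F B.
  by rewrite /F; bop_field.
have FX : X = F X by rewrite {2}XE FD /F -!(ZE _ _).2.
set a := inner (X y) f; set b := inner (X f) y.
have Yyf : inner (Y y) f = b^* by rewrite YE -adjointPr inner_conj.
have Yfy : inner (Y f) y = a^* by rewrite YE -adjointPr inner_conj.
(* The diagonal entry at [f] of the relation [Z t * Z t = P + Q]. *)
have key t : t * t^* = 1 -> (t * b + t^* * a^*) * (t * a + t^* * b^*) = 1.
  move=> /ZE[ZZ ZF].
  have Zf : Z t f = (t * b + t^* * a^*) *: y.
    rewrite ZF !bopE fy ff scale0r scaler0 add0r scale1r ?bopE !innerE.
    by rewrite Yfy.
  have := congr1 (fun A : bop H => inner (A f) f) ZZ.
  rewrite bopME Zf bop_appZ !bopE !innerE fy ff.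
  by rewrite mul0r addr0 mulr1 Yyf.
have k1 := key 1 t1; rewrite conjC1 !mul1r in k1.
have ki := key 'i ti; rewrite conjCi in ki.
(* The phases 1 and ['i] only show that [a * b] plus its conjugate is 0; the nonzero imaginary part
   24/25 of the square of [t3] then forces [a * b = 0]. *)
pose t3 : C := 3 / 5 + 4 / 5 * 'i.
have t3C : t3^* = 3 / 5 - 4 / 5 * 'i.
  by rewrite rmorphD /= conjq rmorphM /= conjq conjCi mulrN.
have {}ki : (b - a^*) * (a - b^*) = -1.
  by apply: oppr_inj; rewrite opprK -[RHS]ki -[LHS]mulN1r -sqrCi; ring.
have n1 : a * a^* + b * b^* = 1.
  rewrite (_ : _ + _ = 2^-1 * ((b + a^*) * (a + b^*) - (b - a^*) * (a - b^*))).
    by rewrite k1 ki; field.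
  by field.
have ab' : a^* * b^* = - (a * b).
  apply/eqP; rewrite -subr_eq0 opprK.
  rewrite (_ : _ + _ = 2^-1 * ((b + a^*) * (a + b^*) + (b - a^*) * (a - b^*))).
    by rewrite k1 ki subrr mulr0.
  by field.
have t33 : t3 * t3^* = 1.
  transitivity (9 / 25 - 16 / 25 * 'i ^+ 2 : C); last by rewrite sqrCi; field.
  by rewrite t3C /t3; field.
have k3 := key t3 t33.
have ab : a * b = 0.
  have c0 : 48 / 25 * 'i != 0 :> C.
    by rewrite !mulf_neq0 ?invr_eq0 ?pnatr_eq0 ?neq0Ci.
  apply: (mulfI c0); rewrite mulr0.
  transitivity ((t3 * b + t3^* * a^*) * (t3 * a + t3^* * b^*) -
      t3 * t3^* * (a * a^* + b * b^*) - t3^* ^+ 2 * (a * b + a^* * b^*)).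
    by rewrite t3C /t3; field.
  by rewrite k3 t33 n1 ab' subrr mulr0 mulr1 subrr subr0.
exists y, a, b; do 2 split => //.
by rewrite -/Y YE {1}FX /F adjointD !adjointZ !adjoint_rank_one.
Qed.

(* The two alternatives hold on subspaces covering the complement of [u]. *)
Lemma preserver_dichotomy :
  (forall v, inner v u = 0 -> phi (rank_one u v) f = 0) \/
  (forall v, inner v u = 0 -> phi (rank_one v u) f = 0).
Proof.
have AB v : inner v u = 0 ->
    phi (rank_one u v) f = 0 \/ phi (rank_one v u) f = 0.
  have [->|v0] := eqVneq v 0; first by rewrite rank_one0l preserver0; right.
  move=> vu; have [w ww vE] := exists_unit v0.
  have wu : inner w u = 0.
    by apply: (mulfI (_ : `|v| != 0)); rewrite ?normr_eq0// mulr0 -innerZl -vE.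
  have [y [a [b [[yy yf ab _] [_ Xw Yw]]]]] := preserver_offdiag ww wu.
  have fy := inner_eq0 yf.
  rewrite vE rank_oneZl rank_oneZr !phiZ Xw Yw !bopE ff fy !scale0r !scaler0.
  rewrite addr0 add0r !scale1r; move/eqP: ab; rewrite mulf_eq0.
  by case/orP => /eqP->; [left; rewrite conjC0|right]; rewrite scale0r scaler0.
have [|/existsNP[v1 /not_implyP[v1u A1]]] :=
  pselect (forall v, inner v u = 0 -> phi (rank_one u v) f = 0); first by left.
right=> v vu; have [A2|//] := AB v vu.
have [|B1] := AB v1 v1u; first by [].
(* The first alternative for [v1 + v] would carry over to [v1], against its choice; the second
   carries over to [v]. *)
have v2u : inner (v1 + v) u = 0 by rewrite innerDl v1u vu addr0.
have [] := AB _ v2u.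
  by rewrite rank_oneDr phiD bopDE A2 addr0.
by rewrite rank_oneDl phiD bopDE B1 add0r.
Qed.

(* [b] tells whether [W] is antilinear. *)
Lemma preserver_wigner : exists (b : bool) (W : H -> H),
  [/\ forall x y, W (x + y) = W x + W y,
      forall a x, W (a *: x) = (if b then a^* else a) *: W x
    & forall x, phi (rank_one x x) = rank_one (W x) (W x)].
Proof.
have [b Hb] : exists b : bool, forall v, inner v u = 0 ->
    phi (if b then rank_one v u else rank_one u v) f = 0.
  by have [hA|hB] := preserver_dichotomy; [exists false|exists true].
(* Both cases are treated at once: the image of [r u v] kills [f], while that of [r v u] defines
   [W]. *)
pose r x y : bop H := if b then rank_one y x else rank_one x y.
pose W x := phi (r x u) f.
have WD x y : W (x + y) = W x + W y.
  by rewrite /W /r; case: (b); rewrite ?rank_oneDl ?rank_oneDr phiD.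
have WZ a x : W (a *: x) = (if b then a^* else a) *: W x.
  by rewrite /W /r; case: (b); rewrite ?rank_oneZl ?rank_oneZr phiZ.
have Wu : W u = f by rewrite /W /r if_same phi_u rank_oneE ff scale1r.
have W_unit w : inner w w = 1 -> inner w u = 0 ->
    [/\ phi (rank_one w w) = rank_one (W w) (W w),
        phi (r w u) = rank_one (W w) f & phi (r u w) = rank_one f (W w)].
  (* By [Hb] one coefficient vanishes, so the other is unimodular and [W w] is a unimodular multiple
     of [y]; the factor cancels in [rank_one (W w) (W w)]. *)
  move=> ww wu; have := Hb w wu.
  have [y [c [d [[yy yf cd nn] [Zw Xw Yw]]]]] := preserver_offdiag ww wu.
  have fy := inner_eq0 yf; have y0 : y != 0.
    by apply/eqP => y0; move/eqP: yy; rewrite y0 inner0l eq_sym oner_eq0.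
  rewrite /W /r Zw; case: (b); rewrite Xw Yw !bopE fy ff !scale0r !scaler0;
    rewrite ?add0r ?addr0 scale1r => /eqP; rewrite scaler_eq0 (negbTE y0) orbF.
    move=> /eqP d0; move: nn; rewrite d0 conjC0 mul0r addr0 => cc.
    rewrite !rank_oneZl !rank_oneZr conjCK scalerA mulrC cc scale1r.
    by rewrite !scale0r !addr0.
  rewrite conjC_eq0 => /eqP c0; move: nn; rewrite c0 conjC0 mul0r add0r => dd.
  rewrite !rank_oneZl !rank_oneZr scalerA dd scale1r.
  by rewrite !scale0r !add0r.
have W_orth v : inner v u = 0 ->
    [/\ phi (rank_one v v) = rank_one (W v) (W v),
        phi (r v u) = rank_one (W v) f & phi (r u v) = rank_one f (W v)].
  have [-> _|v0 vu] := eqVneq v 0.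
    have -> : W 0 = 0 by rewrite /W /r rank_one0l rank_one0r if_same preserver0.
    by rewrite /r !rank_one0l !rank_one0r !if_same preserver0.
  have [w ww vE] := exists_unit v0.
  have nv0 : `|v| != 0 by rewrite normr_eq0.
  have wu : inner w u = 0 by apply: (mulfI nv0); rewrite mulr0 -innerZl -vE.
  have kR : `|v|^* = `|v| by rewrite conj_Creal ?normr_real.
  move: `|v| kR vE => k kR ->; have [h1 h2 h3] := W_unit w ww wu.
  have WkE : W (k *: w) = k *: W w by rewrite WZ kR if_same.
  rewrite WkE !rank_oneZl !rank_oneZr !phiZ h1 kR; split=> //.
    by rewrite -h2 -phiZ /r; case: (b); rewrite ?rank_oneZl ?rank_oneZr ?kR.
  by rewrite -h3 -phiZ /r; case: (b); rewrite ?rank_oneZl ?rank_oneZr ?kR.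
exists b, W; split=> // x.
have [v vu xE] : exists2 v, inner v u = 0 & x = v + inner x u *: u.
  by exists (x - inner x u *: u); rewrite ?subrK// !innerE uu mulr1 subrr.
move: (inner x u) xE => a ->; have [Wvv Wvu Wuv] := W_orth v vu.
rewrite WD WZ Wu !rank_oneDl !rank_oneDr !rank_oneZl !rank_oneZr !phiD !phiZ.
move: Wvu Wuv; rewrite Wvv phi_u /r.
by case: (b) => -> ->; rewrite ?conjCK; bop_field.
Qed.

(** [W] preserves inner products up to conjugation, and is onto because [psi] also preserves
    rank-one projections. So the vectors [W (e n)] are complete and a unitary [U] maps [e] to them.
    Comparing matrix entries on [e] alone covers both the linear and the antilinear case. *)
Lemma preserver_unitary : exists U : bop H, unitary U /\
  ((forall T, phi T = U * T * adjoint U) \/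
   (forall T, phi T = U * transpose e T * adjoint U)).
Proof.
have [b [W [WD WZ WW]]] := preserver_wigner.
have W0 : W 0 = 0.
  rewrite -[0 in LHS](scale0r (0 : H)) WZ.
  by case: (b); rewrite ?conjC0 scale0r.
have W_unit x : inner x x = 1 -> inner (W x) (W x) = 1.
  move=> xx; have [y yy E] := preserver_rank_one xx.
  have [_ pp] := projection_rank_one yy; have := rank_one_neq0 yy.
  move: pp; rewrite -E WW mul_rank_one rank_oneE rank_oneZl => pp n0.
  have /eqP : (inner (W x) (W x) - 1) *: rank_one (W x) (W x) = 0.
    by rewrite scalerBl pp scale1r subrr.
  by rewrite scaler_eq0 (negbTE n0) orbF subr_eq0 => /eqP.
have W_norm x : inner (W x) (W x) = inner x x.
  have [->|x0] := eqVneq x 0; first by rewrite W0.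
  have [w ww xE] := exists_unit x0.
  have kR : `|x|^* = `|x| by rewrite conj_Creal ?normr_real.
  by move: `|x| kR xE => k kR ->; rewrite WZ kR if_same !innerE ww W_unit.
have W_inner x y : inner (W x) (W y) = if b then inner y x else inner x y.
  have i0 : 'i != 0 :> C := neq0Ci C.
  (* Polarisation: the two norm identities are combined to isolate one inner product. *)
  have := W_norm (x + y); have := W_norm (x + 'i *: y).
  rewrite !WD WZ !innerE !W_norm => /eqP; rewrite -subr_eq0 => /eqP.
  rewrite conjCi; case: (b) => hi /eqP; rewrite -subr_eq0 => /eqP h1;
    apply/eqP; rewrite -subr_eq0; apply/eqP.
    have := congr2 (fun k l => k / 2 + l / (2 * 'i)) h1 hi.
    by rewrite !mul0r addr0 => <-; rewrite rmorphN /= conjCi; field.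
  have := congr2 (fun k l => k / 2 - l / (2 * 'i)) h1 hi.
  by rewrite !mul0r subr0 => <-; rewrite conjCi; field.
have W_scale a x : exists x', W x' = a *: W x.
  exists ((if b then a^* else a) *: x).
  by rewrite WZ; case: (b); rewrite ?conjCK.
have W_surj z : exists x, W x = z.
  have [->|z0] := eqVneq z 0; first by exists 0.
  have [w ww ->] := exists_unit z0.
  have [x xx E] := inverse_preserver_rank_one ww.
  have := WW x; rewrite -E psiK => /(congr1 (fun A : bop H => A w)).
  by rewrite !rank_oneE ww scale1r => ->; rewrite scalerA; exact: W_scale.
have W_complete z : (forall i, inner z (W (e i)) = 0) -> z = 0.
  have [x <-] := W_surj z => xe.
  suff -> : x = 0 by [].
  apply: basis_inj => i; rewrite inner0l; have := xe i; rewrite W_inner.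
  by case: (b) => // /inner_eq0.
have oW : orthonormal_seq (fun n => W (e n)).
  move=> i j; rewrite W_inner !basis_orthonormal eq_sym.
  by case: (b).
have [U [UU Ue]] := exists_isometric oW.
have UU' : U * adjoint U = 1.
  apply: bopP => z; apply/eqP; rewrite -subr_eq0; apply/eqP/W_complete => i.
  rewrite -Ue innerDl innerNl bopME bop1E ((isometricP U).1 UU) adjointPr.
  exact: subrr.
exists U; split=> //.
(* [x] is split along the range and the kernel of [P]; on unit vectors of each part, preservation of
   orthogonality to [rank_one w w] decides the value. *)
have phiW P x : infinite_coinfinite_projection P -> phi P (W x) = W (P x).
  move=> /infinite_coinfiniteW cP; have PP y : P (P y) = P y.
    by rewrite -bopME (proj2 cP.1).
  have fixP y : P y = y -> phi P (W y) = W y.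
    have [-> _|y0 Py] := eqVneq y 0; first by rewrite W0 bop_app0.
    have [w ww yE] := exists_unit y0.
    have Pw : P w = w.
      have ny0 : `|y| != 0 by rewrite normr_eq0.
      by apply: (scalerI ny0); rewrite -bop_appZ -yE.
    have := preserver_orth (coinfiniteB_rank_one cP ww Pw)
      (coinfinite_rank_one ww).
    rewrite subrK => /(_ cP)/(congr1 (fun A : bop H => A (W w))).
    rewrite phiD preserverN WW bopME rank_oneE W_unit// scale1r !bopE W_unit//.
    rewrite scale1r => /eqP; rewrite subr_eq0 => /eqP phiPw.
    by rewrite yE WZ bop_appZ phiPw.
  have kerP y : P y = 0 -> phi P (W y) = 0.
    have [-> _|y0 Py] := eqVneq y 0; first by rewrite W0 bop_app0.
    have [w ww yE] := exists_unit y0.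
    have Pw : P w = 0.
      have ny0 : `|y| != 0 by rewrite normr_eq0.
      by apply: (scalerI ny0); rewrite -bop_appZ -yE scaler0.
    have := preserver_orth cP (coinfinite_rank_one ww)
      (coinfiniteD_rank_one cP ww Pw).
    move=> /(congr1 (fun A : bop H => A (W w))).
    rewrite WW bopME rank_oneE W_unit// scale1r => phiPw.
    by rewrite yE WZ bop_appZ phiPw scaler0.
  rewrite -[x in LHS](subrK (P x)) WD bop_appD (fixP _ (PP x)) kerP ?add0r//.
  by rewrite bop_appD bop_appN PP subrr.
have entries T i j : inner ((adjoint U * phi T * U) (e i)) (e j) =
    if b then inner (T (e j)) (e i) else inner (T (e i)) (e j).
  (* The relation is linear in [T], so [span_full] reduces it to the projections of infinite rank
     and corank. *)
  pose L T := forall i j, inner ((adjoint U * phi T * U) (e i)) (e j) =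
    if b then inner (T (e j)) (e i) else inner (T (e i)) (e j).
  suff : L T by apply.
  apply: span_full => {T i j} [A B LA LB i j|a A LA i j|P icP i j].
  - by rewrite phiD mulrDr mulrDl !bopDE !innerDl LA LB; case: (b).
  - by rewrite phiZ -bop_scaleAr -bop_scaleAl !bopZE !innerZl LA; case: (b).
  rewrite !bopME -adjointPr !Ue phiW// W_inner.
  have [[aP _] _] := infinite_coinfiniteW icP.
  by case: (b) => //; rewrite adjointP aP.
have phiE T : phi T = U * (adjoint U * phi T * U) * adjoint U.
  by rewrite !mulrA UU' mul1r -mulrA UU' mulr1.
case: (b) entries => entries; [right|left] => T; rewrite [LHS]phiE.
  congr (_ * _ * _).
  (* [adjoint U * phi T * U] itself satisfies the defining relation of the transpose, so [xget] does
     not return its default. *)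
  have tP : exists T' : bop H,
      forall i j, inner (T' (e i)) (e j) = inner (T (e j)) (e i).
    by exists (adjoint U * phi T * U).
  apply: bop_matrix_inj => i j; rewrite entries.
  by have := xgetPex 0 tP => /= ->.
congr (_ * _ * _).
by apply: bop_matrix_inj.
Qed.

End preserver.
End basis.

Theorem theorem3 (R : realType) (H : hilbertType R)
  (Hseparable : separable_space H)
  (Hinfinite : infinite_hilbert_dim [set: H])
  (e : nat -> H) (e_complete : complete_orthonormal_sequence e)
  (phi : {linear bop H -> bop H}) (phi_bij : bijective phi)
  (phi_proj : forall P : bop H,
    infinite_coinfinite_projection P <->
    infinite_coinfinite_projection (phi P)) :
  exists U : bop H, unitary U /\
    ((forall T : bop H, phi T = U * T * adjoint U) \/
     (forall T : bop H, phi T = U * transpose e T * adjoint U)).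
Proof.
case: phi_bij => psi phiK psiK.
have phiD : {morph phi : A B / A + B} by exact: linearD.
have phiZ a : {morph phi : A / a *: A} by exact: linearZZ.
(* Any unit vector can serve as the base vector [u]; the first basis vector is taken. *)
have uu : inner (e 0%N) (e 0%N) = 1 by rewrite (basis_orthonormal e_complete).
have [f ff phi_u] := preserver_rank_one e_complete phiK psiK phiD phi_proj uu.
exact: (preserver_unitary e_complete phiK psiK phiD phiZ phi_proj uu ff phi_u).
Qed.
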